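(* Let $A,B\in\mathrm{PSL}(2,\mathbb{R})$ be such that $\langle A,B\rangle$ contains elliptic elements and $\mathrm{tr}([A,B])>2$. Then the Extended Trace Minimization Algorithm, applied to the trace triple $(\mathrm{tr}(A),\mathrm{tr}(B),\mathrm{tr}(AB))$, returns ''not discrete'' or computes a trace triple $(x,y,z)$ of a pair $(U,V)\in\mathrm{PSL}(2,\mathbb{R})^2$ such that the following conditions are satisfied. (a) The pair $(U,V)$ is obtained from $(A,B)$ by a series of Nielsen transformations and extended Nielsen transformations. (b) $0\le x\le y$. (c) If $y\ge 2$ then $z\le -2$. (d) $x=2\cos(\pi/p)$ for some $p\ge 2$. (e) If $y<2$ then $y=2\cos(\pi/q)$ for some $q\ge p$. (f) If $y<2$ then either $z\le -2$, or $|z|\ge y$ and $|z|=2\cos(r\pi/s)$ with $s\ge 2$, $1\le r\le s-1$, and $\gcd(r,s)=1$. (g) $2<\mathrm{tr}([U,V])\le\mathrm{tr}([A,B])$.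
   Context: $\mathrm{PSL}(2,\mathbb{R})=\mathrm{SL}(2,\mathbb{R})/\{\pm I_2\}$. An element $A\neq E$ is elliptic if $|\mathrm{tr}(A)|<2$. $[A,B]=ABA^{-1}B^{-1}$, whose trace is well defined. A trace triple of a pair $(U,V)$ is $(\mathrm{tr}(\hat U),\mathrm{tr}(\hat V),\mathrm{tr}(\hat U\hat V))$ for representatives $\hat U,\hat V\in\mathrm{SL}(2,\mathbb{R})$; changing representatives switches two of the three signs. Nielsen transformations are finite compositions of $(A,B)\mapsto(B,A)$, $(A,B)\mapsto(A^{-1},B)$, $(A,B)\mapsto(A,BA)$. An extended Nielsen transformation is a passage from a pair $(U,V)$ to $(U^r,V)$, in particular the normalization step: for $U$ of finite order $q\geq 3$ with $|\mathrm{tr}(U)|=2\cos(p\pi/q)$, $\gcd(p,q)=1$, one takes $r$ with $rp-sq=1$. Chebyshev S-polynomials: $S_0(t)=0$, $S_1(t)=1$, $S_i(t)=t\,S_{i-1}(t)-S_{i-2}(t)$ for $i\ge 2$. Rational angle recovery: for $0\le x<2$, decide whether $x=2\cos(p\pi/q)$ with $q\ge 2$, $1\le p\le q-1$, $\gcd(p,q)=1$; return this (unique) pair $(p,q)$, or $(0,0)$ if there is none. If the pair satisfies $p>1$, let $\mathrm{NormExp}(x)$ be an integer $r\ge 1$ such that $rp-sq=1$ for some integer $s\ge 0$, computed by the Extended Euclidean Algorithm (with $r<q$). Trace Minimization Algorithm. Input: a trace triple $(a,b,c)$ of a pair with commutator trace $\tau=a^2+b^2+c^2-abc-2\ne 2$.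 In the case $\tau>2$: permute the triple and, if necessary, switch two of the three signs to get $0\le x\le y\le|z|$; as long as no entry is negative, replace $(x,y,z)$ by the numbers $x,y,xy-z$ in increasing order; finally return the two non-negative entries in increasing order followed by the negative entry. Extended Trace Minimization Algorithm. Convention: after each step the signs of two entries of the triple are switched if necessary (change of representatives) so that the first two entries are $\ge 0$. (1) Apply the Trace Minimization Algorithm to get $(x,y,z)$. (2) Permute so that $0\le x\le y\le |z|$. (3) Apply rational angle recovery to $x$, obtaining $(p,q)$; if $(p,q)=(0,0)$ return ''not discrete''. (4) If $p>1$, let $r=\mathrm{NormExp}(x)$ and replace $(x,y,z)$ by $(xS_r(x)-2S_{r-1}(x),\ y,\ S_r(x)z-S_{r-1}(x)y)$. (5) If $|z|<y$, interchange $y$ and $z$. (6) If $y\ge 2$ and $z\ge 2$, replace $(x,y,z)$ by $(x,y,xy-z)$ and go to (2). Else, if $y\ge 2$ and $z\le -2$, return $(x,y,z)$. (7) Apply rational angle recovery to $y$, obtaining $(p',q')$; if $(p',q')=(0,0)$ return ''not discrete''. (8) If $p'>1$, let $r'=\mathrm{NormExp}(y)$ and replace $(x,y,z)$ by $(x,\ yS_{r'}(y)-2S_{r'-1}(y),\ S_{r'}(y)z-S_{r'-1}(y)x)$. (9) If $y<x$, interchange $x$ and $y$. (10) If $z\ge 2$, replace $(x,y,z)$ by $(x,y,xy-z)$ and go to (2). Else, if $|z|<2$: apply rational angle recovery to $|z|$, obtaining $(p'',q'')$; if $(p'',q'')=(0,0)$ return ''not discrete''; if $p''>1$ and $|z|<y$,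 go to (2). (11) Return $(x,y,z)$.
   Formalization: Step (10) as stated can return a triple with |z|<y<2, violating (f): input (φ−1,φ−1,−3φ−1), φ the golden ratio, gives (φ,φ,−1). Only in that case, (a)–(g) are asserted for the returned triple after permuting and switching signs to get 0≤x≤y≤|z|. *)

(* Defs.v *)
From HB Require Import structures.
From mathcomp Require Import all_boot all_order all_algebra.
From mathcomp Require Import all_classical all_reals all_analysis.

Set Implicit Arguments.
Unset Strict Implicit.
Unset Printing Implicit Defensive.

Import Order.TTheory GRing.Theory Num.Theory.

Local Open Scope quotient_scope.
Local Open Scope ring_scope.

(** * SL(2,R) and PSL(2,R) as [groupType]s *)

Record SL2 (R : realType) :=
  MkSL2 { sl2_mx :> 'M[R]_2 ; sl2_det : \det sl2_mx == 1 }.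

HB.instance Definition _ (R : realType) := [isSub for @sl2_mx R].
HB.instance Definition _ (R : realType) := [Choice of SL2 R by <:].

Lemma sl2_one_subproof (R : realType) : \det (1%:M : 'M[R]_2) == 1.
Proof. by rewrite det1. Qed.

Lemma sl2_opp_subproof (R : realType) (M : SL2 R) : \det (- sl2_mx M) == 1.
Proof. by rewrite -scaleN1r detZ sqrrN expr1n mul1r; case: M. Qed.

Lemma sl2_inv_subproof (R : realType) (M : SL2 R) :
  \det (invmx (sl2_mx M)) == 1.
Proof. by rewrite det_inv (eqP (sl2_det M)) invr1. Qed.

Lemma sl2_mul_subproof (R : realType) (M N : SL2 R) :
  \det (sl2_mx M *m sl2_mx N) == 1.
Proof. by rewrite det_mulmx (eqP (sl2_det M)) (eqP (sl2_det N)) mulr1. Qed.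

Definition sl2_one (R : realType) := MkSL2 (sl2_one_subproof R).
Definition sl2_opp (R : realType) (M : SL2 R) := MkSL2 (sl2_opp_subproof M).
Definition sl2_inv (R : realType) (M : SL2 R) := MkSL2 (sl2_inv_subproof M).
Definition sl2_mul (R : realType) (M N : SL2 R) := MkSL2 (sl2_mul_subproof M N).

Lemma sl2_unit (R : realType) (M : SL2 R) : sl2_mx M \in unitmx.
Proof. by rewrite unitmxE (eqP (sl2_det M)) unitr1. Qed.

Lemma sl2_mulA (R : realType) : associative (@sl2_mul R).
Proof. by move=> M N P; apply/val_inj; rewrite /= mulmxA. Qed.
Lemma sl2_mul1 (R : realType) : left_id (sl2_one R) (@sl2_mul R).
Proof. by move=> M; apply/val_inj; rewrite /= mul1mx. Qed.
Lemma sl2_mulr1 (R : realType) : right_id (sl2_one R) (@sl2_mul R).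
Proof. by move=> M; apply/val_inj; rewrite /= mulmx1. Qed.
Lemma sl2_mulV (R : realType) :
  left_inverse (sl2_one R) (@sl2_inv R) (@sl2_mul R).
Proof. by move=> M; apply/val_inj; rewrite /= mulVmx// sl2_unit. Qed.
Lemma sl2_mulrV (R : realType) :
  right_inverse (sl2_one R) (@sl2_inv R) (@sl2_mul R).
Proof. by move=> M; apply/val_inj; rewrite /= mulmxV// sl2_unit. Qed.

HB.instance Definition _ (R : realType) := isGroup.Build (SL2 R)
  (@sl2_mulA R) (@sl2_mul1 R) (@sl2_mulr1 R) (@sl2_mulV R) (@sl2_mulrV R).

Definition sl2_sim (R : realType) (M N : SL2 R) : bool :=
  (N == M) || (N == sl2_opp M).

Lemma sl2_oppK (R : realType) : involutive (@sl2_opp R).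
Proof. by move=> M; apply/val_inj; rewrite /= opprK. Qed.

Lemma sl2_sim_refl (R : realType) : reflexive (@sl2_sim R).
Proof. by move=> M; rewrite /sl2_sim eqxx. Qed.
Lemma sl2_sim_sym (R : realType) : symmetric (@sl2_sim R).
Proof.
move=> M N; rewrite /sl2_sim eq_sym; congr (_ || _).
by rewrite -(inj_eq (inv_inj (@sl2_oppK R))) sl2_oppK eq_sym.
Qed.
Lemma sl2_sim_trans (R : realType) : transitive (@sl2_sim R).
Proof.
move=> N M P; rewrite /sl2_sim => /orP[] /eqP-> /orP[] /eqP->;
  by rewrite ?sl2_oppK eqxx ?orbT.
Qed.

Canonical sl2_sim_equiv (R : realType) := EquivRel (@sl2_sim R)
  (@sl2_sim_refl R) (@sl2_sim_sym R) (@sl2_sim_trans R).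

Definition PSL2 (R : realType) := {eq_quot (@sl2_sim R)}.
HB.instance Definition _ (R : realType) := Choice.on (PSL2 R).
HB.instance Definition _ (R : realType) := EqQuotient.on (PSL2 R).

(** The canonical projection; [M : SL2 R] is a representative of [U] when
    [psl M = U]. *)
Definition psl (R : realType) (M : SL2 R) : PSL2 R := \pi_(PSL2 R) M.

Lemma psl_eq (R : realType) (M N : SL2 R) :
  psl M = psl N <-> N = M \/ N = sl2_opp M.
Proof.
rewrite /psl; split=> [/eqP|h]; first rewrite eqmodE.
  by case/orP=> /eqP; [left | right].
by apply/eqP; rewrite eqmodE; apply/orP; case: h => ->; [left | right].
Qed.

Lemma psl_repr (R : realType) (U : PSL2 R) : psl (repr U) = U.
Proof. exact: reprK. Qed.

Definition psl_mul (R : realType) (U V : PSL2 R) : PSL2 R :=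
  psl (sl2_mul (repr U) (repr V)).
Definition psl_inv (R : realType) (U : PSL2 R) : PSL2 R :=
  psl (sl2_inv (repr U)).

Lemma sl2_mulN (R : realType) (M N : SL2 R) :
  sl2_mul M (sl2_opp N) = sl2_opp (sl2_mul M N).
Proof. by apply/val_inj; rewrite /= mulmxN. Qed.
Lemma sl2_mulNl (R : realType) (M N : SL2 R) :
  sl2_mul (sl2_opp M) N = sl2_opp (sl2_mul M N).
Proof. by apply/val_inj; rewrite /= mulNmx. Qed.
Lemma sl2_invN (R : realType) (M : SL2 R) :
  sl2_inv (sl2_opp M) = sl2_opp (sl2_inv M).
Proof.
apply: (@mulgI (SL2 R) (sl2_opp M)).
change (sl2_mul (sl2_opp M) (sl2_inv (sl2_opp M)) =
        sl2_mul (sl2_opp M) (sl2_opp (sl2_inv M))).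
by rewrite sl2_mulrV sl2_mulN sl2_mulNl sl2_oppK sl2_mulrV.
Qed.

Lemma psl_mulE (R : realType) (M N : SL2 R) :
  psl_mul (psl M) (psl N) = psl (sl2_mul M N).
Proof.
rewrite /psl_mul; apply/psl_eq.
have /esym/psl_eq[->|->] := psl_repr (psl M);
have /esym/psl_eq[->|->] := psl_repr (psl N);
  rewrite ?sl2_mulN ?sl2_mulNl ?sl2_oppK; by [left | right].
Qed.

Lemma psl_invE (R : realType) (M : SL2 R) :
  psl_inv (psl M) = psl (sl2_inv M).
Proof.
rewrite /psl_inv; apply/psl_eq.
by have /esym/psl_eq[->|->] := psl_repr (psl M);
  rewrite ?sl2_invN ?sl2_oppK; [left | right].
Qed.

Lemma psl_mulA (R : realType) : associative (@psl_mul R).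
Proof.
by move=> U V W; rewrite -(psl_repr U) -(psl_repr V) -(psl_repr W) !psl_mulE
  sl2_mulA.
Qed.
Lemma psl_mul1 (R : realType) : left_id (psl (sl2_one R)) (@psl_mul R).
Proof. by move=> U; rewrite -(psl_repr U) psl_mulE sl2_mul1. Qed.
Lemma psl_mulr1 (R : realType) : right_id (psl (sl2_one R)) (@psl_mul R).
Proof. by move=> U; rewrite -(psl_repr U) psl_mulE sl2_mulr1. Qed.
Lemma psl_mulV (R : realType) :
  left_inverse (psl (sl2_one R)) (@psl_inv R) (@psl_mul R).
Proof. by move=> U; rewrite -(psl_repr U) psl_invE psl_mulE sl2_mulV. Qed.
Lemma psl_mulrV (R : realType) :
  right_inverse (psl (sl2_one R)) (@psl_inv R) (@psl_mul R).
Proof. by move=> U; rewrite -(psl_repr U) psl_invE psl_mulE sl2_mulrV. Qed.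

HB.instance Definition _ (R : realType) := isGroup.Build (PSL2 R)
  (@psl_mulA R) (@psl_mul1 R) (@psl_mulr1 R) (@psl_mulV R) (@psl_mulrV R).

(** * Traces *)

Notation triple R := (R * R * R)%type.

Definition abs_tr (R : realType) (U : PSL2 R) : R := `|\tr (sl2_mx (repr U))|.

Lemma abs_tr_psl (R : realType) (M : SL2 R) :
  abs_tr (psl M) = `|\tr (sl2_mx M)|.
Proof.
rewrite /abs_tr; have /esym/psl_eq[->//|->] := psl_repr (psl M).
by rewrite /= linearN normrN.
Qed.

(** MathComp's [[~ x, y]] is [x^-1 y^-1 x y], hence the explicit commutator. *)
Definition comm_tr (R : realType) (U V : PSL2 R) : R :=
  \tr (sl2_mx (repr U * repr V * (repr U)^-1 * (repr V)^-1)%g).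

Lemma comm_tr_psl (R : realType) (M N : SL2 R) :
  comm_tr (psl M) (psl N) = \tr (sl2_mx (M * N * M^-1 * N^-1)%g).
Proof.
rewrite /comm_tr; congr (\tr (sl2_mx _)).
change (sl2_mul (sl2_mul (sl2_mul (repr (psl M)) (repr (psl N)))
          (sl2_inv (repr (psl M)))) (sl2_inv (repr (psl N))) =
        sl2_mul (sl2_mul (sl2_mul M N) (sl2_inv M)) (sl2_inv N)).
by have /esym/psl_eq[->|->] := psl_repr (psl M);
   have /esym/psl_eq[->|->] := psl_repr (psl N);
   rewrite ?sl2_invN ?sl2_mulNl ?sl2_mulN ?sl2_mulNl ?sl2_oppK.
Qed.

Definition elliptic (R : realType) (U : PSL2 R) : Prop :=
  U <> 1%g /\ abs_tr U < 2.

Inductive generated (R : realType) (A B : PSL2 R) : PSL2 R -> Prop :=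
| gen_one : generated A B 1%g
| gen_left : generated A B A
| gen_right : generated A B B
| gen_mul U V : generated A B U -> generated A B V -> generated A B (U * V)%g
| gen_inv U : generated A B U -> generated A B U^-1%g.

Definition trace_triple (R : realType) (U V : PSL2 R) (t : triple R) : Prop :=
  exists M N : SL2 R, [/\ psl M = U, psl N = V &
    t = (\tr (sl2_mx M), \tr (sl2_mx N), \tr (sl2_mx (M * N)%g))].

(** * Extended Nielsen transformations *)

(** [U] has finite order [q >= 3] and absolute trace [2 cos (p pi / q)], and
    [r] is an inverse of [p] modulo [q]. *)
Definition normalizing_power (R : realType) (U : PSL2 R) (r : nat) : Prop :=
  exists p q s : nat,
    [/\ (3 <= q)%N,
        (U ^+ q = 1)%g /\ (forall k, (0 < k < q)%N -> (U ^+ k <> 1)%g),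
        coprime p q,
        abs_tr U = 2 * cos (p%:R * pi / q%:R) &
        (r * p = s * q + 1)%N].

(** [ext_nielsen A B U V]: the pair [(U, V)] is obtained from [(A, B)] by a
    finite sequence of Nielsen and extended Nielsen transformations. *)
Inductive ext_nielsen (R : realType) (A B : PSL2 R) :
    PSL2 R -> PSL2 R -> Prop :=
| en_refl : ext_nielsen A B A B
| en_swap U V : ext_nielsen A B U V -> ext_nielsen A B V U
| en_inv U V : ext_nielsen A B U V -> ext_nielsen A B U^-1%g V
| en_mul U V : ext_nielsen A B U V -> ext_nielsen A B U (V * U)%g
| en_pow U V r : ext_nielsen A B U V -> normalizing_power U r ->
    ext_nielsen A B (U ^+ r)%g V.

(** * The subroutines of the algorithm *)

Fixpoint chebS (R : realType) (n : nat) (t : R) : R :=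
  match n with
  | 0 => 0
  | S m => match m with
           | 0 => 1
           | S k => t * chebS m t - chebS k t
           end
  end.

Definition is_rational_angle (R : realType) (x : R) (p q : nat) : Prop :=
  [/\ (2 <= q)%N, (1 <= p <= q - 1)%N, coprime p q &
      x = 2 * cos (p%:R * pi / q%:R)].

(** Rational angle recovery.  [cos] is injective on [[0, pi]], so that there is
    at most one pair to choose. *)
Definition rat_angle (R : realType) (x : R) : nat * nat :=
  xget (0%N, 0%N) [set pq : nat * nat | is_rational_angle x pq.1 pq.2]%classic.

Definition norm_exp (R : realType) (x : R) : nat :=
  let: (p, q) := rat_angle x in (egcdn p q).1.

Lemma norm_exp_spec (R : realType) (x : R) (p q : nat) :
  rat_angle x = (p, q) -> (1 < p)%N ->
  (1 <= norm_exp x < q)%N /\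
  exists s : nat, (norm_exp x * p = s * q + 1)%N.
Proof.
rewrite /norm_exp => e p1; rewrite e.
have [q2 pq cpq] : [/\ (2 <= q)%N, (1 <= p <= q - 1)%N & coprime p q].
  move: e; rewrite /rat_angle; case: xgetP => [[p' q'] _ /= [? ? ? _] [<- <-] //|].
  by move=> _ [p0]; rewrite -p0 in p1.
have p0 : (0 < p)%N by apply: leq_trans p1.
case: (egcdnP q p0) => km kn; rewrite (eqP cpq) muln1 => ekm lkn /=.
split; last by exists kn.
have km0 : (0 < km)%N by case: km ekm => //; rewrite mul0n addn1.
rewrite km0 /= -(ltn_pmul2r p0) ekm.
have: (kn.+1 * q <= p * q)%N by rewrite leq_mul2r lkn orbT.
rewrite [(p * q)%N]mulnC; apply: leq_trans.
by rewrite mulSn [(q + _)%N]addnC ltn_add2l.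
Qed.

(** Change of representatives making the first two entries nonnegative; when
    one of them is zero and the other is negative, the negative entry and the
    third one are switched. *)
Definition switch_signs (R : realType) (t : triple R) : triple R :=
  let: (x, y, z) := t in
  if x < 0 then (if y < 0 then (- x, - y, z) else (- x, y, - z))
  else (if y < 0 then (x, - y, - z) else (x, y, z)).

Definition sort3 (R : realType) (le : rel R) (t : triple R) : triple R :=
  let: (x, y, z) := t in
  let s := sort le [:: x; y; z] in (s`_0, s`_1, s`_2).

(** Permute, and switch two signs if necessary, to get [0 <= x <= y <= |z|]. *)
Definition arrange (R : realType) (t : triple R) : triple R :=
  switch_signs (sort3 (fun u v => `|u| <= `|v|) t).

(** * The Extended Trace Minimization Algorithm as a transition system *)

Inductive outcome (R : realType) :=
| NotDiscrete
| Triple of triple R.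
Arguments NotDiscrete {R}.

(** [Tma t]: at the head of the loop of the Trace Minimization Algorithm, which
    is the first step; [At k t]: before the [k]-th step; [Stop o]: [o] has been
    returned; [Undefined]: a subroutine has been called outside its domain
    (minimization if the commutator trace [tau] is at most 2, angle recovery
    outside [[0, 2[]). *)
Inductive state (R : realType) :=
| Tma of triple R
| At of nat & triple R
| Stop of outcome R
| Undefined.
Arguments Undefined {R}.

Definition tau (R : realType) (t : triple R) : R :=
  let: (x, y, z) := t in x ^+ 2 + y ^+ 2 + z ^+ 2 - x * y * z - 2.

Definition start (R : realType) (t : triple R) : state R :=
  if 2 < tau t then Tma (arrange t) else Undefined.

Definition etma_step (R : realType) (st : state R) : state R :=
  match st with
  | Tma (x, y, z) =>
      (* after an iteration the entries are increasing, so that a negative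
         entry comes first; before the first one only [z] can be negative *)
      if x < 0 then At 2 (switch_signs (y, z, x))
      else if z < 0 then At 2 (switch_signs (x, y, z))
      else Tma (sort3 <=%R (x, y, x * y - z))
  | At 2 t => At 3 (arrange t)
  | At 3 (x, y, z) =>
      if ~~ (0 <= x < 2) then Undefined
      else if rat_angle x == (0%N, 0%N) then Stop NotDiscrete
      else At 4 (x, y, z)
  | At 4 (x, y, z) =>
      if (1 < (rat_angle x).1)%N then
        let r := norm_exp x in
        At 5 (switch_signs (x * chebS r x - 2 * chebS r.-1 x, y,
                            chebS r x * z - chebS r.-1 x * y))
      else At 5 (x, y, z)
  | At 5 (x, y, z) =>
      if `|z| < y then At 6 (switch_signs (x, z, y)) else At 6 (x, y, z)
  | At 6 (x, y, z) =>
      if (2 <= y) && (2 <= z) then At 2 (switch_signs (x, y, x * y - z))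
      else if (2 <= y) && (z <= -2) then Stop (Triple (x, y, z))
      else At 7 (x, y, z)
  | At 7 (x, y, z) =>
      if ~~ (0 <= y < 2) then Undefined
      else if rat_angle y == (0%N, 0%N) then Stop NotDiscrete
      else At 8 (x, y, z)
  | At 8 (x, y, z) =>
      if (1 < (rat_angle y).1)%N then
        let r := norm_exp y in
        At 9 (switch_signs (x, y * chebS r y - 2 * chebS r.-1 y,
                            chebS r y * z - chebS r.-1 y * x))
      else At 9 (x, y, z)
  | At 9 (x, y, z) =>
      if y < x then At 10 (switch_signs (y, x, z)) else At 10 (x, y, z)
  | At 10 (x, y, z) =>
      if 2 <= z then At 2 (switch_signs (x, y, x * y - z))
      else if `|z| < 2 then
        let p := (rat_angle `|z|).1 in
        if rat_angle `|z| == (0%N, 0%N) then Stop NotDiscrete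
        else if (1 < p)%N && (`|z| < y) then At 2 (x, y, z)
        else At 11 (x, y, z)
      else At 11 (x, y, z)
  | At 11 (x, y, z) => Stop (Triple (x, y, z))
  | _ => st
  end.

Definition etma_returns (R : realType) (t : triple R) (o : outcome R) : Prop :=
  exists n : nat, iter n (@etma_step R) (start t) = Stop o.

(** The order [0 <= x <= y <= |z|] is restored for a returned triple with
    [|z| < y], and only then.  [At 10] lets such a triple pass when [|z|]
    recovers to a pair [(1, q)]: the input [(phi - 1, phi - 1, - 3 phi - 1)],
    with [phi] the golden ratio, is sent to [(phi, phi, -1)]. *)
Definition in_order (R : realType) (t : triple R) : triple R :=
  let: (x, y, z) := t in if `|z| < y then arrange (x, y, z) else (x, y, z).

(* Main.v *)
(* Normalizing an elliptic generator A to A^r multiplies tau - 2 by S_r(x)^2,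
   where x = tr A; this factor is sin^2(pi/q) / sin^2(p pi/q) < 1, so the
   commutator trace never increases and every proper normalization decreases it.

   The domain of the subroutines is respected because a minimized triple with all
   entries of absolute value at least 2 has x, y >= 2 and z <= -2, and then the
   group is of index at most 2 in a group generated by reflections in three
   pairwise disjoint lines; by ping-pong such a group has no elliptic elements.

   Termination is the main point.  As long as y >= 2, the passage from (x, y, z)
   to (x, y, xy - z) keeps the normalized x and decreases y + |z| by at least
   2 (2 - x).  Every other way of returning to step 2 soon stops or leads to a
   triple all of whose entries are +-2 cos(p pi/q).  From then on all entries lie in
   Q(2 cos(pi/N)) for a fixed N, and a number 2 cos(p pi/q) in this field has
   bounded denominator q since cyclotomic polynomials are irreducible.  Hence only
   finitely many values of tau can occur at such triples, while tau decreases
   strictly from one of them to the next. *)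
Require Import Defs.
From mathcomp Require Import all_boot all_order all_algebra all_field.
From mathcomp Require Import all_classical all_reals all_analysis.
From mathcomp Require Import complex.
From mathcomp Require Import ring lra.

Set Implicit Arguments.
Unset Strict Implicit.
Unset Printing Implicit Defensive.

Import Order.TTheory GRing.Theory Num.Theory.
Local Open Scope ring_scope.

(** * Ping-pong for hyperbolic reflections *)

Lemma ord2_ind (P : 'I_2 -> Prop) : P 0 -> P 1 -> forall i, P i.
Proof.
move=> P0 P1 [[|[|//]] h].
- by rewrite (_ : Ordinal h = 0) //; apply/val_inj.
- by rewrite (_ : Ordinal h = 1) //; apply/val_inj.
Qed.

Lemma sum2E (V : nmodType) (F : 'I_2 -> V) : \sum_i F i = F 0 + F 1.
Proof.
rewrite big_ord_recl big_ord1; congr (_ + F _); exact/val_inj.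
Qed.

Lemma mxtrace2 (R : pzRingType) (A : 'M[R]_2) : \tr A = A 0 0 + A 1 1.
Proof. exact: sum2E. Qed.

Lemma det2 (R : comPzRingType) (A : 'M[R]_2) :
  \det A = A 0 0 * A 1 1 - A 0 1 * A 1 0.
Proof.
rewrite (expand_det_row _ 0) sum2E /cofactor !det_mx11 !mxE /=.
rewrite (_ : lift 0 0 = 1); last exact/val_inj.
rewrite (_ : lift 1 0 = 0); last exact/val_inj.
by rewrite expr0 expr1 mul1r mulN1r mulrN.
Qed.

Lemma mulmx2E (R : pzRingType) (A B : 'M[R]_2) i j :
  (A *m B) i j = A i 0 * B 0 j + A i 1 * B 1 j.
Proof. by rewrite mxE sum2E. Qed.

Lemma mx2P (R : Type) (A B : 'M[R]_2) :
  A 0 0 = B 0 0 -> A 0 1 = B 0 1 -> A 1 0 = B 1 0 -> A 1 1 = B 1 1 -> A = B.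
Proof.
by move=> h00 h01 h10 h11; apply/matrixP; elim/ord2_ind; elim/ord2_ind.
Qed.

Definition mx2E := (mxtrace2, det2, mulmx2E, mxE, mulr1n, mulr0n).

Lemma cayley2 (R : comPzRingType) (A : 'M[R]_2) :
  A *m A = \tr A *: A - (\det A)%:M.
Proof. by apply: mx2P; rewrite !mx2E /= ?mulr1n ?mulr0n; ring. Qed.

(** * Traceless 2x2 matrices as a Minkowski space for the trace form *)

Section Traceless.
Variable R : realFieldType.
Implicit Types A B C J X Y : 'M[R]_2.

Lemma traceless_trX J : \tr J = 0 -> \tr (J *m J) = - \det J *+ 2.
Proof.
rewrite !mx2E => /eqP; rewrite addr_eq0 => /eqP->; ring.
Qed.

Lemma traceless_anticomm X Y : \tr X = 0 -> \tr Y = 0 ->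
  X *m Y + Y *m X = (\tr (X *m Y))%:M.
Proof.
rewrite !mx2E => /eqP; rewrite addr_eq0 => /eqP hX /eqP.
rewrite addr_eq0 => /eqP hY.
by apply: mx2P; rewrite !mx2E /= ?mulr1n ?mulr0n ?hX ?hY; ring.
Qed.

(** Reversed Cauchy-Schwarz inequality for the traceless matrices [[[a, b], [c, -a]]] and
    [[[a', b'], [c', -a']]]. Four times the determinant is [(b - c)^2 - (b + c)^2 - 4 a^2], so
    [b - c] is the time coordinate and its sign distinguishes the nappes of the light cone. *)
Lemma nappe_ineq (a b c a' b' c' : R) : 0 < - a ^+ 2 - b * c ->
  0 <= - a' ^+ 2 - b' * c' -> b' - c' != 0 ->
  (2 * a * a' + b * c' + c * b') * ((b - c) * (b' - c')) < 0.
Proof.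
move=> h1 h2.
pose h := b - c; pose k := b + c; pose h' := b' - c'; pose k' := b' + c'.
rewrite -/h -/h' => h'0.
have H1 : 4 * a ^+ 2 + k ^+ 2 < h ^+ 2 by rewrite /h /k; nra.
have H2 : 4 * a' ^+ 2 + k' ^+ 2 <= h' ^+ 2 by rewrite /h' /k'; nra.
pose u := 4 * a * a' + k * k'.
have Hu : u ^+ 2 < (h * h') ^+ 2.
  apply: (@le_lt_trans _ _ ((4 * a ^+ 2 + k ^+ 2) * (4 * a' ^+ 2 + k' ^+ 2))).
    (* Lagrange's identity for the spatial parts [(2 a, k)] and [(2 a', k')]. *)
    rewrite -subr_ge0 (_ : _ - _ = 4 * (a * k' - a' * k) ^+ 2); last first.
      by rewrite /u; ring.
    by rewrite mulr_ge0 ?sqr_ge0.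
  apply: (@le_lt_trans _ _ ((4 * a ^+ 2 + k ^+ 2) * h' ^+ 2)).
    by rewrite ler_wpM2l //; nra.
  by rewrite exprMn ltr_pM2r // lt_neqAle eq_sym sqrf_eq0 h'0 sqr_ge0.
have -> : (2 * a * a' + b * c' + c * b') = (u - h * h') / 2.
  by rewrite /u /h /h' /k /k'; field.
have : u * (h * h') < (h * h') ^+ 2.
  rewrite expr2; set v := h * h' in Hu *.
  have [v0|v0] := leP 0 v; have [u0|u0] := leP 0 u; nra.
nra.
Qed.

(* Timelike vectors [X], [Y] in opposite nappes of the light cone. *)
Lemma nappe_trans X Y C : \tr X = 0 -> \tr Y = 0 -> \tr C = 0 ->
  0 < \det X -> 0 < \det Y -> 0 <= \det C ->
  0 < \tr (X *m Y) -> \tr (Y *m C) < 0 -> 0 < \tr (X *m C).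
Proof.
rewrite !mx2E; move: (X 0 0) (X 0 1) (X 1 0) (X 1 1) => a b c d.
move: (Y 0 0) (Y 0 1) (Y 1 0) (Y 1 1) => a' b' c' d'.
move: (C 0 0) (C 0 1) (C 1 0) (C 1 1) => a2 b2 c2 d2.
move=> /eqP; rewrite addrC addr_eq0 => /eqP->.
move=> /eqP; rewrite addrC addr_eq0 => /eqP->.
move=> /eqP; rewrite addrC addr_eq0 => /eqP-> dX dY dC tXY tYC.
have hY : b' - c' != 0.
  by apply: contraTneq dY => /eqP; rewrite subr_eq0 => /eqP->; rewrite -leNgt; nra.
have hC : b2 - c2 != 0.
  apply: contraTneq tYC => /eqP; rewrite subr_eq0 => /eqP hb; rewrite -leNgt.
  have : - a2 ^+ 2 - b2 ^+ 2 >= 0 by move: dC; rewrite hb; nra.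
  move=> dC'; have a20 : a2 = 0 by nra.
  have b20 : b2 = 0 by nra.
  by rewrite a20 -hb b20; nra.
have := @nappe_ineq a b c a' b' c'; have := @nappe_ineq a b c a2 b2 c2.
have := @nappe_ineq a' b' c' a2 b2 c2.
move=> /(_ _ _ hC) H1 /(_ _ _ hC) H2 /(_ _ _ hY) H3.
have {}H1 := H1 ltac:(nra) ltac:(nra).
have {}H2 := H2 ltac:(nra) ltac:(nra).
have {}H3 := H3 ltac:(nra) ltac:(nra).
set h := b - c in H2 H3; set h' := b' - c' in H1 H3; set h2 := b2 - c2 in H1 H2.
(* By the sign rule [Y] and [C] share a nappe, and [X] lies in the other one. *)
have K1 : 0 < h' * h2 by nra.
have K3 : h * h' < 0 by nra.
have K2 : h * h2 < 0.
  have : (h * h2) * (h' ^+ 2) < 0 by rewrite (_ : _ * _ = (h * h') * (h' * h2)); [nra|ring].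
  by have := sqr_ge0 h'; nra.
nra.
Qed.

Lemma timelike_tr_neq0 X Y : \tr X = 0 -> \tr Y = 0 ->
  0 < \det X -> 0 < \det Y -> \tr (X *m Y) != 0.
Proof.
rewrite !mx2E; move: (X 0 0) (X 0 1) (X 1 0) (X 1 1) => a b c d.
move: (Y 0 0) (Y 0 1) (Y 1 0) (Y 1 1) => a' b' c' d'.
move=> /eqP; rewrite addrC addr_eq0 => /eqP->.
move=> /eqP; rewrite addrC addr_eq0 => /eqP-> dX dY.
have hY : b' - c' != 0.
  by apply: contraTneq dY => /eqP; rewrite subr_eq0 => /eqP->; rewrite -leNgt; nra.
have := @nappe_ineq a b c a' b' c' ltac:(nra) ltac:(nra) hY.
by apply: contraTneq => h; rewrite (_ : _ + _ + _ = 0) ?mul0r ?ltxx // -h; ring.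
Qed.

End Traceless.

Definition mxprod (R : pzRingType) (I : Type) (r : I -> 'M[R]_2) w :=
  foldr (fun i => mulmx (r i)) 1%:M w.

Lemma mxprod_cat (R : pzRingType) (I : Type) (r : I -> 'M[R]_2) u v :
  mxprod r (u ++ v) = mxprod r u *m mxprod r v.
Proof. by elim: u => [|i u IH] /=; rewrite ?mul1mx // IH mulmxA. Qed.

Lemma mxprod_rev (R : pzRingType) (I : Type) (r : I -> 'M[R]_2) :
  (forall i, r i *m r i = 1%:M) ->
  forall w, mxprod r w *m mxprod r (rev w) = 1%:M.
Proof.
move=> r_sq; elim=> [|i w IH]; first exact: mul1mx.
rewrite rev_cons -cats1 mxprod_cat /= mulmx1.
by rewrite mulmxA -(mulmxA (r i)) IH mulmx1 r_sq.
Qed.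

(* Ping-pong for a group generated by reflections in pairwise disjoint lines of
   the hyperbolic plane.  Traceless matrices form a Minkowski space for the
   trace form; [r i] is the unit normal of the [i]-th line, and a product of
   evenly many [r i] with trace in ]-2, 2[ would fix a timelike vector [J].  The
   half-plane of [i] is [tr (J r_i) <= 0], and every reflection pushes [J]
   strictly deeper into its own half-plane. *)
Section PingPong.
Variables (R : realFieldType) (I : eqType) (r : I -> 'M[R]_2) (G : 'M[R]_2).
Hypotheses (r_tr : forall i, \tr (r i) = 0) (r_sq : forall i, r i *m r i = 1%:M).
Hypothesis r_far : forall i j, i != j -> \tr (r i *m r j) <= - 2.
Hypotheses (G_tr : \tr G = 0) (G_det : 0 < \det G).
Hypothesis G_r : forall i, \tr (G *m r i) < 0.

Let opposite J := [/\ \tr J = 0, 0 < \det J & 0 < \tr (J *m G)].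

(** Orthogonal reflection along [r i]; no factor 2 appears because [r i] has square norm
    [tr (r_i r_i) = 2]. *)
Let refl i J := J - \tr (J *m r i) *: r i.

(** The vector [r i + r j] is not spacelike, its square having trace [4 + 2 tr (r_i r_j) <= 0], and
    it lies in the nappe of [G]. Hence no [J] of the opposite nappe lies in two half-planes at
    once. *)
Let sepE J i j : opposite J -> i != j -> 0 < \tr (J *m r i) + \tr (J *m r j).
Proof.
case=> J0 J1 J2 ij; rewrite -linearD /= -mulmxDr.
have h : \tr (r i + r j) = 0 by rewrite linearD /= !r_tr addr0.
apply: (nappe_trans J0 G_tr) => //; last first.
  by rewrite mulmxDr linearD /=; have := G_r i; have := G_r j; lra.
have := traceless_trX h; rewrite mulmxDl !mulmxDr !r_sq.
have := r_far ij; rewrite !linearD /= mxtrace1 (mxtrace_mulC (r j)).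
by rewrite mulr2n; lra.
Qed.

Let tr_refl i J X : \tr (refl i J *m X) = \tr (J *m X) - \tr (J *m r i) * \tr (r i *m X).
Proof. by rewrite /refl mulmxBl linearB /= -scalemxAl linearZ. Qed.

Let opposite_refl i J : opposite J -> opposite (refl i J).
Proof.
case=> J0 J1 J2.
have T0 : \tr (refl i J) = 0 by rewrite /refl linearB linearZ /= r_tr J0 mulr0 subr0.
have D0 : \det (refl i J) = \det J.
  have := traceless_trX T0; rewrite tr_refl (mxtrace_mulC J) (mxtrace_mulC (r i)).
  rewrite !tr_refl (traceless_trX J0) r_sq mxtrace1 (mxtrace_mulC (r i)) !mulr2n.
  by move=> h; lra.
split=> //; first by rewrite D0.
(* The trace of [J] times its image is [-2 det J - tr (J r_i)^2 < 0], so both lie in the same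
   nappe. *)
rewrite mxtrace_mulC; apply: (nappe_trans G_tr J0 T0) => //.
- by rewrite D0 ltW.
- by rewrite mxtrace_mulC.
- rewrite mxtrace_mulC tr_refl traceless_trX // (mxtrace_mulC (r i)) -expr2.
  by have := sqr_ge0 (\tr (J *m r i)); rewrite mulr2n; lra.
Qed.

Let act w J := foldr refl J w.

Let opposite_act w J : opposite J -> opposite (act w J).
Proof. by move=> h; elim: w => //= i w; exact: opposite_refl. Qed.

Let reflE i J : \tr J = 0 -> refl i J = - (r i *m J *m r i).
Proof.
move=> J0; have /(congr1 (mulmx^~ (r i))) := traceless_anticomm J0 (r_tr i).
rewrite mulmxDl -!mulmxA r_sq mulmx1 mul_scalar_mx /refl => <-.
by rewrite opprD addrA subrr add0r mulmxA.
Qed.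

(** Reflecting is conjugation by [r i] up to sign. A vector that commutes with an even word is
    therefore fixed by the action of that word. *)
Let actE w J : opposite J -> act w J = (-1) ^+ size w *: (mxprod r w *m J *m mxprod r (rev w)).
Proof.
move=> h; elim: w => [|i w IH]; first by rewrite /= scale1r mul1mx mulmx1.
rewrite [LHS]/= reflE; last by case: (opposite_act w h).
rewrite -/(act w J) IH rev_cons -cats1 mxprod_cat /= mulmx1 exprS mulN1r scaleNr.
by rewrite -scalemxAr -scalemxAl !mulmxA.
Qed.

(** The last letter acts first. It sends [J] into its half-plane at depth [tr (J r_last)]; by [sepE]
    the image lies outside the next half-plane by more than that depth, and the next reflection
    moves it inside. So the depth never drops. *)
Let chain i w J : opposite J -> path (fun a b => a != b) i w ->
  0 <= \tr (J *m r (last i w)) ->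
  \tr (act (i :: w) J *m r i) <= - \tr (J *m r (last i w)).
Proof.
move=> h; elim: w i => [|j w IH] i /=.
  by move=> _ _; rewrite tr_refl r_sq mxtrace1; lra.
case/andP=> ij /IH {}IH /IH {}IH.
have := sepE (opposite_act (j :: w) h) ij.
rewrite [in X in _ -> X]tr_refl r_sq mxtrace1; move: IH => /=; lra.
Qed.

(** By [sepE], [J] is outside one of the two end half-planes, so [chain] applies to the word or to
    its reverse. As [J] is fixed, the two end traces then have sum at most 0, against [sepE]. *)
Let reduced_absurd i w J : opposite J -> path (fun a b => a != b) i w ->
  i != last i w -> act (i :: w) J = J -> act (rev (i :: w)) J = J -> False.
Proof.
move=> h hp il e1 e2.
have := sepE h il; have [f0|f0] := leP 0 (\tr (J *m r (last i w))).
  by have := chain h hp f0; rewrite e1; lra.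
have hr : rev (i :: w) = last i w :: rev (belast i w).
  by rewrite lastI rev_rcons.
have hp' : path (fun a b => a != b) (last i w) (rev (belast i w)).
  by rewrite rev_path; apply: sub_path hp => a b; rewrite eq_sym.
have hl : last (last i w) (rev (belast i w)) = i.
  by case: (w) il => [|j v] /=; rewrite ?eqxx // rev_cons last_rcons.
move=> s0; have := chain h hp'; rewrite hl -hr e2 => /(_ ltac:(lra)); lra.
Qed.

(** Induction on the length: equal end letters are removed by conjugation, equal neighbours by
    cancellation, and parity is kept. What remains is a cyclically reduced word, which
    [reduced_absurd] forbids to fix a timelike vector. *)
Lemma reflections_trace_ge2 w : ~~ odd (size w) ->
  2 <= `|\tr (mxprod r w)|.
Proof.
have [n] := ubnP (size w); elim: n w => // n IH [|i w] /=; rewrite ?ltnS.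
  by rewrite mxtrace1 ger0_norm.
move=> hn ho; rewrite leNgt; apply/negP => hlt.
have [il|il] := eqVneq i (last i w).
  case/lastP: w => [|w j] in hn ho hlt il *; first by rewrite /= in ho.
  move: il hlt hn ho; rewrite last_rcons size_rcons => <- hlt hn ho.
  move: hlt; rewrite -cats1 mxprod_cat /= mulmx1 mxtrace_mulC.
  rewrite -mulmxA r_sq mulmx1 ltNge => /negP; apply.
  by apply: IH; [exact: ltnW|rewrite /= !negbK in ho *].
case: (boolP (path (fun a b => a != b) i w)) => hp; last first.
  have [u [v [j huv]]] : exists u v j, i :: w = u ++ j :: j :: v.
    elim: w i hp {hn ho hlt il} => //= j w IHw i; rewrite negb_and negbK.
    case/orP => [/eqP<-|/IHw[u [v [k ->]]]]; first by exists [::], w, i.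
    by exists (i :: u), v, k.
  have hs : size (i :: w) = (size (u ++ v)).+2 by rewrite huv !size_cat /= !addnS.
  move: hlt; rewrite -[_ *m _]/(mxprod r (i :: w)) huv mxprod_cat /=.
  rewrite (mulmxA (r j)) r_sq mul1mx -mxprod_cat ltNge => /negP; apply.
  case: hs => hs; apply: IH; first by rewrite -hs ltnW.
  by move: ho; rewrite hs /= negbK.
pose P := mxprod r (i :: w); pose t := \tr P.
have hP : \det P = 1.
  have hd j : \det (r j) = -1.
    by have := traceless_trX (r_tr j); rewrite r_sq mxtrace1 mulr2n; lra.
  have : \det P = (-1) ^+ size (i :: w).
    rewrite /P; elim: (i :: w) => [|j v IHv] /=; first by rewrite det1.
    by rewrite det_mulmx hd IHv exprS.
  by rewrite -signr_odd /= (negbTE ho).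
(* The traceless part of [P] commutes with [P] and has determinant [1 - t^2 / 4 > 0]; it or its
   negative lies in the nappe opposite to [G]. *)
pose J0 : 'M[R]_2 := P - (t / 2)%:M.
have J0tr : \tr J0 = 0.
  by rewrite /J0 linearB /= mxtrace_scalar -/t mulr2n; lra.
have J0det : 0 < \det J0.
  have : \det J0 = \det P - t ^+ 2 / 4.
    by rewrite /J0 /t !mx2E /= ?mulr1n ?mulr0n; field.
  by rewrite hP; move: hlt; rewrite -[_ *m _]/P -/t ltr_norml => /andP[? ?] ->; nra.
have J0P : P *m J0 = J0 *m P.
  by rewrite /J0 mulmxBl mulmxBr scalar_mxC.
have J0G : \tr (J0 *m G) != 0 by exact: timelike_tr_neq0.
have [J [hJ hJP]] : exists J, opposite J /\ P *m J = J *m P.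
  have [h|h|h] := ltgtP 0 (\tr (J0 *m G)); last by rewrite -h eqxx in J0G.
    by exists J0.
  exists (- J0); split; last by rewrite mulmxN mulNmx J0P.
  split; first by rewrite linearN /= J0tr oppr0.
    by rewrite -scaleN1r detZ sqrrN expr1n mul1r.
  by rewrite mulNmx linearN /= oppr_gt0.
apply: (reduced_absurd hJ hp il).
  rewrite actE // -[X in X *m J]/P hJP -mulmxA mxprod_rev // mulmx1.
  by rewrite -signr_odd /= (negbTE ho) scale1r.
rewrite actE // revK size_rev -[mxprod r (i :: w)]/P -mulmxA -hJP mulmxA.
have := mxprod_rev r_sq (rev (i :: w)); rewrite revK -[mxprod r (i :: w)]/P => ->.
by rewrite mul1mx -signr_odd /= (negbTE ho) scale1r.
Qed.

End PingPong.

(** * Traces in SL(2,R) *)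

Section TracesInSL2.
Variable R : realType.
Implicit Types (M N : SL2 R) (U V W A B : PSL2 R).

Lemma sl2_invE M : sl2_mx M^-1%g = (\tr (sl2_mx M))%:M - sl2_mx M.
Proof.
rewrite -[LHS]/(invmx (sl2_mx M)); have := cayley2 (sl2_mx M).
rewrite (eqP (sl2_det M)) => h; apply: (can_inj (mulKmx (sl2_unit M))).
rewrite mulmxV ?sl2_unit // mulmxBr h mul_mx_scalar.
by rewrite opprB addrC subrK.
Qed.

(** Iterated Cayley-Hamilton: powers of a matrix of determinant 1 obey the recurrence of the
    S-polynomials. *)
Lemma sl2_powE M n : sl2_mx (M ^+ n.+1)%g =
  chebS n.+1 (\tr (sl2_mx M)) *: sl2_mx M - (chebS n (\tr (sl2_mx M)))%:M.
Proof.
elim: n => [|n IH]; first by rewrite scale1r raddf0 subr0.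
rewrite expgS -[LHS]/(sl2_mx M *m sl2_mx (M ^+ n.+1)%g) IH.
rewrite mulmxBr -scalemxAr cayley2 (eqP (sl2_det M)) mul_mx_scalar.
rewrite [chebS n.+2 _]/= scalerBr scalerBl scalerA scale_scalar_mx mulr1.
by rewrite -/(chebS n.+1 _) (mulrC (\tr _)) addrAC.
Qed.

Lemma fricke M N : comm_tr (psl M) (psl N) =
  tau (\tr (sl2_mx M), \tr (sl2_mx N), \tr (sl2_mx (M * N)%g)).
Proof.
rewrite comm_tr_psl.
rewrite -[sl2_mx _]/(sl2_mx M *m sl2_mx N *m sl2_mx M^-1%g *m sl2_mx N^-1%g).
rewrite -[sl2_mx (M * N)%g]/(sl2_mx M *m sl2_mx N) !sl2_invE /tau.
have := eqP (sl2_det M); have := eqP (sl2_det N).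
move: (sl2_mx M) (sl2_mx N) => {M N} A B dB dA.
set u := \tr A; set v := \tr B.
(* With the determinants inserted, this is a polynomial identity for arbitrary 2x2 matrices. *)
transitivity (u ^+ 2 * \det B + v ^+ 2 * \det A + \tr (A *m B) ^+ 2
  - u * v * \tr (A *m B) - 2 * (\det A * \det B)); last by rewrite dA dB !mulr1.
by rewrite /u /v !mx2E /= ?mulr1n ?mulr0n; ring.
Qed.

End TracesInSL2.

(** * Triples with [x, y >= 2] and [z <= -2]: groups without elliptic elements *)

Section Hyperbolic.
Variables (R : realType) (M N : SL2 R).
Let x := \tr (sl2_mx M).
Let y := \tr (sl2_mx N).
Let z := \tr (sl2_mx (M * N)%g).
Hypotheses (hx : 2 <= x) (hy : 2 <= y) (hz : z <= - 2).
Hypothesis htau : 2 < tau (x, y, z).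

(** A reflection that conjugates both generators to their inverses. The matrix [M N - N M] is
    traceless of determinant [2 - tau < 0], and is scaled to determinant -1. *)
Let K : 'M[R]_2 := (Num.sqrt (tau (x, y, z) - 2))^-1 *:
  (sl2_mx M *m sl2_mx N - sl2_mx N *m sl2_mx M).

Let K_tr : \tr K = 0.
Proof. by rewrite /K linearZ linearB /= mxtrace_mulC subrr mulr0. Qed.

Let K_det : \det K = -1.
Proof.
rewrite /K detZ exprVn sqr_sqrtr; last by rewrite subr_ge0 ltW.
have -> : \det (sl2_mx M *m sl2_mx N - sl2_mx N *m sl2_mx M) =
    - (tau (x, y, z) - 2).
  rewrite /tau /x /y /z -[sl2_mx (M * N)%g]/(sl2_mx M *m sl2_mx N).
  have := eqP (sl2_det M); have := eqP (sl2_det N).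
  move: (sl2_mx M) (sl2_mx N) => A B dB dA.
  transitivity (- (\tr A ^+ 2 * \det B + \tr B ^+ 2 * \det A
     + \tr (A *m B) ^+ 2 - \tr A * \tr B * \tr (A *m B)
     - 4 * (\det A * \det B))); first by rewrite !mx2E /=; ring.
  by rewrite dA dB !mulr1; ring.
by rewrite mulrN mulVf // subr_eq0 gt_eqF.
Qed.

Let K_sq : K *m K = 1%:M.
Proof. by rewrite cayley2 K_tr scale0r K_det sub0r raddfN opprK. Qed.

(* [A = - r1 r2] and [B = - r2 r3]: the group has index 2 in a reflection group. *)
Let r (i : option bool) : 'M[R]_2 :=
  match i with
  | Some false => sl2_mx M *m K | None => - K | Some true => K *m sl2_mx N
  end.

Let r_tr i : \tr (r i) = 0.
Proof.
case: i => [[]|] /=; last by rewrite linearN /= K_tr oppr0.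
  rewrite /K -scalemxAl linearZ /= mulmxBl linearB /= -!mulmxA.
  by rewrite (mxtrace_mulC (sl2_mx N) (_ *m _)) -!mulmxA subrr mulr0.
rewrite /K -scalemxAr linearZ /= mulmxBr linearB /= !mulmxA.
by rewrite (mxtrace_mulC (sl2_mx M *m sl2_mx N)) mulmxA subrr mulr0.
Qed.

Let r_sq i : r i *m r i = 1%:M.
Proof.
rewrite cayley2 r_tr scale0r sub0r.
rewrite (_ : \det (r i) = -1) ?raddfN ?opprK //.
case: i => [[]|] /=; rewrite ?det_mulmx ?K_det ?(eqP (sl2_det _)) ?mulr1 ?mul1r //.
by rewrite -scaleN1r detZ K_det sqrrN expr1n mul1r.
Qed.

Let r12 : r (Some false) *m r None = - sl2_mx M.
Proof. by rewrite /= mulmxN -mulmxA K_sq mulmx1. Qed.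

Let r23 : r None *m r (Some true) = - sl2_mx N.
Proof. by rewrite /= mulNmx mulmxA K_sq mul1mx. Qed.

Let r13 : r (Some false) *m r (Some true) = sl2_mx (M * N)%g.
Proof. by rewrite /= mulmxA -(mulmxA (sl2_mx M)) K_sq mulmx1. Qed.

Let r_far i j : i != j -> \tr (r i *m r j) <= -2.
Proof.
wlog: i j / (i, j) \in [:: (Some false, None); (None, Some true);
                           (Some false, Some true)].
  move=> W ij; case: (boolP ((i, j) \in [:: (Some false, None);
      (None, Some true); (Some false, Some true)])) => h; first exact: W.
  rewrite mxtrace_mulC; apply: W; last by rewrite eq_sym.
  by move: i j ij h => [[]|] [[]|].
rewrite !inE => /or3P[] /eqP[-> ->] _; rewrite ?r12 ?r23 ?r13 // linearN /= lerN2 //.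
Qed.

(** The sum of the normals pairs with each of them to at most [2 - 2 - 2 < 0]. Adding these pairings
    gives [tr (G G) < 0], so [G] is timelike. *)
Let G := r (Some false) + r None + r (Some true).

Let G_r i : \tr (G *m r i) < 0.
Proof.
rewrite /G !mulmxDl !mxtraceD.
have rr j : \tr (r j *m r j) = 2 by rewrite r_sq mxtrace1.
have far j k := @r_far j k.
case: i => [[]|]; rewrite rr.
- have := far (Some false) (Some true) isT; have := far None (Some true) isT; lra.
- have := far None (Some false) isT; have := far (Some true) (Some false) isT; lra.
- have := far (Some false) None isT; have := far (Some true) None isT; lra.
Qed.

Let G_tr : \tr G = 0.
Proof. by rewrite /G !mxtraceD !r_tr !addr0. Qed.

Let G_det : 0 < \det G.
Proof.
have := traceless_trX G_tr; rewrite {2}/G !mulmxDr !mxtraceD.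
have := G_r (Some false); have := G_r None; have := G_r (Some true).
by rewrite mulr2n; lra.
Qed.

Let word (W : PSL2 R) := exists w (e : bool) (P : SL2 R),
  [/\ ~~ odd (size w), psl P = W & sl2_mx P = (-1) ^+ e *: mxprod r w].

Let word_gen W : generated (psl M) (psl N) W -> word W.
Proof.
elim=> [||| U V _ [u [e [P [ou <- hP]]]] _ [v [f [Q [ov <- hQ]]]]
  | U _ [u [e [P [ou <- hP]]]]].
- by exists [::], false, (sl2_one R); split=> //; rewrite /= scale1r.
- exists [:: Some false; None], true, M; split=> //.
  by rewrite /mxprod /= mulmx1 -/(r None) -[_ *m _]/(r (Some false) *m r None) r12 scaleN1r opprK.
- exists [:: None; Some true], true, N; split=> //.
  by rewrite /mxprod /= mulmx1 -[_ *m _]/(r None *m r (Some true)) r23 scaleN1r opprK.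
- exists (u ++ v), (e (+) f), (P * Q)%g; split.
  + by rewrite size_cat oddD (negbTE ou) (negbTE ov).
  + exact: esym (psl_mulE P Q).
  + rewrite -[LHS]/(sl2_mx P *m sl2_mx Q) hP hQ mxprod_cat signr_addb.
    by rewrite -scalemxAl -scalemxAr scalerA.
- exists (rev u), e, P^-1%g; split; first by rewrite size_rev.
  + exact: esym (psl_invE P).
  + apply: (can_inj (mulKmx (sl2_unit P))).
    rewrite -[sl2_mx P^-1%g]/(invmx (sl2_mx P)) mulmxV ?sl2_unit // hP.
    rewrite -scalemxAl -scalemxAr mxprod_rev // scalerA -signr_addb addbb.
    by rewrite scale1r.
Qed.

Lemma no_elliptic W : generated (psl M) (psl N) W -> ~ elliptic W.
Proof.
move=> /word_gen[w [e [P [ow <- hP]]]] [_]; apply/negP; rewrite -leNgt.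
rewrite abs_tr_psl hP linearZ /= normrM normr_sign mul1r.
exact: (reflections_trace_ge2 r_tr r_sq r_far G_tr G_det G_r).
Qed.

End Hyperbolic.

(** * Rational angles and Chebyshev polynomials *)

Section RationalAngles.
Variable R : realType.
Implicit Types (x t : R) (p q r s n k : nat).

Lemma chebS_sin t n : chebS n (2 * cos t) * sin t = sin (n%:R * t).
Proof.
have [m] := ubnP n; elim: m n => // m IH [|[|n]] hn.
- by rewrite /= !mul0r sin0.
- by rewrite /= !mul1r.
rewrite -[chebS n.+2 _]/(2 * cos t * chebS n.+1 (2 * cos t) - chebS n (2 * cos t)).
rewrite mulrBl -(mulrA (2 * cos t)) (IH n.+1) // (IH n); last by rewrite ltnS in hn; exact: ltnW.
have -> : n.+2%:R * t = n.+1%:R * t + t by rewrite -addn1 natrD; ring.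
have -> : n%:R * t = n.+1%:R * t - t by rewrite -addn1 natrD; ring.
by rewrite sinB sinD; ring.
Qed.

Lemma chebS_cos t n : sin t != 0 ->
  2 * cos t * chebS n.+1 (2 * cos t) - 2 * chebS n (2 * cos t) =
  2 * cos (n.+1%:R * t).
Proof.
move=> st; apply: (mulIf st); rewrite mulrBl -!mulrA !chebS_sin.
have -> : n%:R * t = n.+1%:R * t - t by rewrite -addn1 natrD; ring.
by rewrite sinB; ring.
Qed.

Lemma sin_natpi n : sin (n%:R * pi) = 0 :> R.
Proof.
elim: n => [|n IH]; first by rewrite mul0r sin0.
by rewrite -addn1 natrD mulrDl mul1r sinDpi IH oppr0.
Qed.

Lemma cos_natpi n : cos (n%:R * pi) = (-1) ^+ n :> R.
Proof.
elim: n => [|n IH]; first by rewrite mul0r cos0.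
by rewrite -addn1 natrD mulrDl mul1r cosDpi IH addn1 exprS mulN1r.
Qed.

Let neq20 : 2 != 0 :> R. Proof. by rewrite pnatr_eq0. Qed.

Lemma angle_range p q : (0 < p < q)%N -> 0 < (p%:R * pi / q%:R : R) < pi.
Proof.
case/andP=> p0 pq; have q0 : 0 < q%:R :> R by rewrite ltr0n (leq_ltn_trans _ pq).
have pp : 0 < pi :> R by exact: pi_gt0.
apply/andP; split; first by rewrite divr_gt0 // mulr_gt0 // ltr0n.
by rewrite ltr_pdivrMr // mulrC ltr_pM2l // ltr_nat.
Qed.

Lemma angle_inI p q : (0 < p < q)%N -> (p%:R * pi / q%:R : R) \in `[0, pi].
Proof. by move=> /angle_range/andP[h1 h2]; rewrite in_itv /= !ltW. Qed.

Lemma rational_angle_bounds x p q : is_rational_angle x p q -> (0 < p < q)%N.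
Proof.
case=> q2 /andP[p1 pq] _ _; rewrite p1 /=.
by case: q q2 pq => // q _; rewrite subn1 ltnS.
Qed.

Lemma rational_angle_sin_gt0 x p q : is_rational_angle x p q ->
  0 < sin (p%:R * pi / q%:R : R).
Proof. by move=> /rational_angle_bounds/angle_range; exact: sin_gt0_pi. Qed.

Lemma rational_angle_uniq x p q p' q' :
  is_rational_angle x p q -> is_rational_angle x p' q' -> p = p' /\ q = q'.
Proof.
move=> h h'; have b := rational_angle_bounds h; have b' := rational_angle_bounds h'.
case: h h' => [q2 _ c ->] [q2' _ c'] /(mulfI neq20).
move=> /(cos_inj (angle_inI b) (angle_inI b')).
have q0 : q%:R != 0 :> R by rewrite pnatr_eq0; case: (q) q2.
have q0' : q'%:R != 0 :> R by rewrite pnatr_eq0; case: (q') q2'.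
have pi0 : pi != 0 :> R by rewrite gt_eqF // pi_gt0.
move=> /(congr1 (fun u => u * q%:R * q'%:R / pi)).
rewrite (_ : _ / q%:R * _ * _ / _ = (p * q')%:R); last first.
  by rewrite natrM; move: pi pi0 => w w0; field; rewrite w0.
rewrite (_ : _ / q'%:R * _ * _ / _ = (p' * q)%:R); last first.
  by rewrite natrM; move: pi pi0 => w w0; field; rewrite w0.
move=> /eqP; rewrite eqr_nat => /eqP e.
have e1 : (p = p')%N.
  apply/eqP; rewrite eqn_dvd -(Gauss_dvdl p' c) -e dvdn_mulr //=.
  by rewrite -(Gauss_dvdl p c') e dvdn_mulr.
split=> //; move: e; rewrite e1 => /eqP; rewrite eqn_mul2l => /orP[/eqP p0|/eqP-> //].
by move: b'; rewrite p0.
Qed.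

Lemma rat_angle_eq x p q : is_rational_angle x p q -> rat_angle x = (p, q).
Proof.
move=> h; rewrite /rat_angle; case: xgetP => [[p' q'] _ /= h'|].
  by have [-> ->] := rational_angle_uniq h' h.
by move=> /(_ (p, q)).
Qed.

Lemma rat_angleP x : rat_angle x != (0%N, 0%N) ->
  is_rational_angle x (rat_angle x).1 (rat_angle x).2.
Proof. by rewrite /rat_angle; case: xgetP => [[p q] _ h _ //|]; rewrite eqxx. Qed.

Lemma rational_angle_lt2 x p q : is_rational_angle x p q -> `|x| < 2.
Proof.
move=> h; have s0 := rational_angle_sin_gt0 h; case: h s0 => _ _ _ -> s0.
have := cos2Dsin2 (p%:R * pi / q%:R : R).
by move: s0; set c := cos _; set s := sin _; rewrite ltr_norml => *; apply/andP; nra.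
Qed.

Lemma rational_angle_le_half x p q : is_rational_angle x p q -> 0 <= x ->
  (p.*2 <= q)%N.
Proof.
move=> h; have b := rational_angle_bounds h; case: h => [q2 _ _ ->] h0.
have q0 : 0 < q%:R :> R by rewrite ltr0n; case: (q) q2.
have h1 : (pi / 2 : R) \in `[0, pi].
  by rewrite in_itv /=; have := @pi_gt0 R => *; apply/andP; lra.
have : cos (pi / 2) <= cos (p%:R * pi / q%:R : R) by rewrite cos_pihalf; lra.
rewrite leNgt (ltr_cos h1 (angle_inI b)) -leNgt.
rewrite ler_pdivrMr // mulrAC ler_pdivlMr // [_ * 2]mulrAC [pi * _]mulrC ler_pM2r ?pi_gt0 //.
by rewrite -natrM ler_nat muln2.
Qed.

Definition normalized x := exists2 q, (2 <= q)%N & x = 2 * cos (pi / q%:R).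

Lemma normalized_angle x q : (2 <= q)%N -> x = 2 * cos (pi / q%:R) ->
  is_rational_angle x 1 q.
Proof.
by move=> q2 ->; split; rewrite ?coprime1n ?mul1r //; case: q q2 => [|[]].
Qed.

Lemma normalized_range x : normalized x -> 0 <= x < 2.
Proof.
case=> q q2 hx; have := rational_angle_lt2 (normalized_angle q2 hx).
rewrite ltr_norml => /andP[_ ->]; rewrite andbT hx mulr_ge0 //.
have pp := @pi_gt0 R; have q2R : 2 <= q%:R :> R by rewrite ler_nat.
apply: cos_ge0_pihalf; apply/andP; split.
  by apply: (@le_trans _ _ 0); [lra|rewrite divr_ge0 ?ltW //; lra].
by rewrite ler_pM2l // lef_pV2 ?posrE //; lra.
Qed.

Lemma normalized_le p q : (2 <= p)%N -> (2 <= q)%N ->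
  2 * cos (pi / p%:R) <= 2 * cos (pi / q%:R) :> R -> (p <= q)%N.
Proof.
move=> p2 q2; rewrite ler_pM2l // leNgt.
have inI n : (2 <= n)%N -> (pi / n%:R : R) \in `[0, pi].
  by move=> n2; rewrite -[pi in pi / _]mul1r; apply: (@angle_inI 1).
rewrite (ltr_cos (inI _ p2) (inI _ q2)) -leNgt ler_pM2l ?pi_gt0 //.
by rewrite lef_pV2 ?posrE ?ltr0n ?ler_nat //; apply: leq_trans (isT : (0 < 2)%N) _.
Qed.

(** From here to the end of the section, [t] is the angle of [x], and [r p = s q + 1] makes [r t]
    equal to [pi / q] up to a multiple of [pi]. *)
Section Normalization.
Variables (x : R) (p q r s : nat).
Hypothesis hx : is_rational_angle x p q.
Hypothesis hr : (r * p = s * q + 1)%N.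

Let t : R := p%:R * pi / q%:R.

Let xE : x = 2 * cos t. Proof. by case: hx. Qed.

Let st : 0 < sin t. Proof. exact: rational_angle_sin_gt0 hx. Qed.

Let q0 : q%:R != 0 :> R.
Proof. by rewrite pnatr_eq0; case: hx; case: (q). Qed.

Let rt : r%:R * t = pi / q%:R + s%:R * pi.
Proof.
have -> : r%:R * t = (r * p)%:R * pi / q%:R by rewrite /t natrM; ring.
by rewrite hr natrD natrM; move: pi => w; field.
Qed.

(** The trace of an [r]-th power is [2 cos (r t)]. The sign [(-1)^s] disappears later in the change
    of representatives. *)
Lemma power_trace : x * chebS r x - 2 * chebS r.-1 x =
  (-1) ^+ s * (2 * cos (pi / q%:R)).
Proof.
have r0 : (0 < r)%N by case: (r) hr => //; rewrite mul0n addn1.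
rewrite -{1}(prednK r0) xE chebS_cos ?gt_eqF // prednK // rt cosD.
by rewrite sin_natpi mulr0 subr0 cos_natpi; ring.
Qed.

Lemma chebS_power_sqr : chebS r x ^+ 2 = (sin (pi / q%:R) / sin t) ^+ 2.
Proof.
have -> : chebS r x = sin (r%:R * t) / sin t.
  by rewrite -chebS_sin -xE mulfK // gt_eqF.
rewrite rt sinD cos_natpi sin_natpi mulr0 addr0 !exprMn -exprM mulnC exprM.
by rewrite sqrrN expr1n expr1n mulr1.
Qed.

Lemma chebS_power_gt0 : 0 < chebS r x ^+ 2.
Proof.
rewrite chebS_power_sqr; apply/exprn_gt0/divr_gt0 => //.
rewrite -[pi in pi / _]mul1r; apply/sin_gt0_pi/(@angle_range 1)/andP; split=> //.
by case: hx.
Qed.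

(** From [p > 1] and [x >= 0] follows [pi / q < t <= pi / 2], where the sine is strictly increasing.
    This is the source of the strict decrease of [tau]. *)
Lemma chebS_power_lt1 : 0 <= x -> (1 < p)%N -> chebS r x ^+ 2 < 1.
Proof.
move=> x0 p1; rewrite chebS_power_sqr.
have /andP[p0 pq] := rational_angle_bounds hx.
have q2 : (1 < q)%N by case: hx.
have /andP[u0 u1] := @angle_range 1 q q2.
have h2 := rational_angle_le_half hx x0.
have qR : 0 < q%:R :> R by rewrite ltr0n (leq_trans _ q2).
have pp := @pi_gt0 R.
have th : t <= pi / 2.
  rewrite /t ler_pdivrMr // mulrAC ler_pdivlMr // mulrAC [pi * _]mulrC.
  by rewrite ler_pM2r // -natrM ler_nat muln2.
have ut : pi / q%:R < t.
  by rewrite /t -{1}[pi]mul1r -!mulrA ltr_pM2r ?divr_gt0 // ltr1n.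
rewrite mul1r in u0 u1.
have hs : sin (pi / q%:R) < sin t.
  by rewrite ltr_sin // in_itv /=; apply/andP; split; lra.
have s0 : 0 < sin (pi / q%:R : R) by apply/sin_gt0_pi/andP.
have d1 : sin (pi / q%:R) / sin t < 1 by rewrite ltr_pdivrMr // mul1r.
have d0 : 0 < sin (pi / q%:R) / sin t by rewrite divr_gt0.
by rewrite expr2; nra.
Qed.

Lemma power_normalized : normalized `|x * chebS r x - 2 * chebS r.-1 x|.
Proof.
have q2 : (2 <= q)%N by case: hx.
have /andP[n0 _] : 0 <= (2 * cos (pi / q%:R) : R) < 2.
  by apply: normalized_range; exists q.
by exists q => //; rewrite power_trace normrM normrX normrN1 expr1n mul1r ger0_norm.
Qed.

End Normalization.

(** The sine of [k p pi / q] vanishes exactly if [q] divides [k p], hence [k] by coprimality. With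
    [sl2_powE] this makes [q] the order in PSL(2,R) of a matrix of trace [x]. *)
Lemma chebS_order_eq0 x p q k : is_rational_angle x p q ->
  (chebS k x == 0) = (q %| k)%N.
Proof.
move=> h; have s0 := rational_angle_sin_gt0 h; have b := rational_angle_bounds h.
case: h s0 => q2 _ c ->; set t := _ * _ / _ => s0.
have qR : 0 < q%:R :> R by rewrite ltr0n (leq_trans _ q2).
rewrite -(inj_eq (mulIf (lt0r_neq0 s0))) mul0r chebS_sin.
have -> : k%:R * t = (k * p %% q)%:R * pi / q%:R + (k * p %/ q)%:R * pi.
  have -> : k%:R * t = (k * p)%:R * pi / q%:R by rewrite /t natrM; ring.
  by rewrite {1}(divn_eq (k * p) q) natrD natrM; move: pi => w; field; rewrite gt_eqF.
rewrite sinD sin_natpi mulr0 addr0 cos_natpi mulf_eq0 signr_eq0 orbF.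
rewrite -(Gauss_dvdl k (_ : coprime q p)); last by rewrite coprime_sym.
rewrite /dvdn; case: (eqVneq (k * p %% q)%N 0%N) => [->|]; first by rewrite !mul0r sin0 eqxx.
rewrite -lt0n => m0; apply/gt_eqF/sin_gt0_pi/angle_range.
by rewrite m0 ltn_pmod // (leq_trans _ q2).
Qed.

Lemma chebS_pred_order x p q : is_rational_angle x p q ->
  chebS q x = 0 /\ exists b : bool, chebS q.-1 x = (-1) ^+ b.
Proof.
move=> h; have e : chebS q x = 0 by apply/eqP; rewrite (chebS_order_eq0 _ h).
split=> //; have s0 := rational_angle_sin_gt0 h.
have q0 : (0 < q)%N by case: h => /ltnW.
(* The value is [- cos (p pi)]. *)
exists (~~ odd p); have := @chebS_cos (p%:R * pi / q%:R) q.-1 (lt0r_neq0 s0).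
case: h e => _ _ _ -> e; rewrite prednK // e mulr0 sub0r.
rewrite (_ : _ * (_ / _) = p%:R * pi); last first.
  by move: pi => w; field; rewrite pnatr_eq0 -lt0n.
rewrite cos_natpi -signr_odd => /eqP; rewrite eqr_oppLR -mulrN => /eqP/(mulfI neq20) ->.
by case: odd; rewrite ?opprK ?expr1 ?expr0.
Qed.

End RationalAngles.

(** * Trace triples under extended Nielsen transformations *)

Section Generation.
Variable R : realType.
Implicit Types U V W A B : PSL2 R.

Lemma generated_trans U V A B W : generated U V A -> generated U V B ->
  generated A B W -> generated U V W.
Proof.
move=> hA hB; elim=> //; first exact: gen_one.
- by move=> *; exact: gen_mul.
- by move=> *; exact: gen_inv.
Qed.

Lemma generated_expg U V W n : generated U V W -> generated U V (W ^+ n)%g.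
Proof.
move=> hW; elim: n => [|n IH]; first by rewrite expg0; exact: gen_one.
by rewrite expgS; exact: gen_mul.
Qed.

(** Every move can be undone; for a power, [(U^r)^p = U] because [U^q = 1] and [r p = s q + 1]. Thus
    an elliptic element of the initial group lies in the group of each pair obtained. *)
Lemma ext_nielsen_generated A B U V : ext_nielsen A B U V ->
  generated U V A /\ generated U V B.
Proof.
elim=> [|{}U {}V _ [h1 h2]|{}U {}V _ [h1 h2]|{}U {}V _ [h1 h2]|{}U {}V r _ [h1 h2]].
- by split; [exact: gen_left|exact: gen_right].
- by split; [apply: generated_trans h1|apply: generated_trans h2];
    (exact: gen_left || exact: gen_right).
- have h : generated U^-1%g V U by rewrite -{2}(invgK U); exact/gen_inv/gen_left.
  by split; [apply: generated_trans h1|apply: generated_trans h2] => //;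
    exact: gen_right.
- have h : generated U (V * U)%g V.
    rewrite -{2}(mulgK U V); apply: gen_mul; first exact: gen_right.
    exact/gen_inv/gen_left.
  by split; [apply: generated_trans h1|apply: generated_trans h2] => //;
    exact: gen_left.
- case=> p [q [s [_ [hq _] _ _ hrp]]].
  have h : generated (U ^+ r)%g V U.
    rewrite [X in generated _ _ X](_ : U = (U ^+ r ^+ p)%g); last first.
      by rewrite -expgnA hrp expgnDr mulnC expgnA hq expg1n mul1g.
    exact/generated_expg/gen_left.
  by split; [apply: generated_trans h1|apply: generated_trans h2] => //;
    exact: gen_right.
Qed.

Lemma psl_expg (M : SL2 R) n : (psl M ^+ n)%g = psl (M ^+ n)%g.
Proof.
elim: n => [|n IH]; first by rewrite !expg0.
by rewrite !expgS IH; exact: psl_mulE.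
Qed.

Lemma normalizing_power_psl (M : SL2 R) p q r s :
  is_rational_angle (\tr (sl2_mx M)) p q -> 0 <= \tr (sl2_mx M) ->
  (1 < p)%N -> (r * p = s * q + 1)%N -> normalizing_power (psl M) r.
Proof.
move=> h x0 p1 e; exists p, q, s; split=> //; last first.
- by rewrite abs_tr_psl ger0_norm //; case: h.
- by case: h.
- have q0 : (0 < q)%N by case: h => /ltnW.
  have powE k : (0 < k)%N -> sl2_mx (M ^+ k)%g = chebS k (\tr (sl2_mx M)) *: sl2_mx M
      - (chebS k.-1 (\tr (sl2_mx M)))%:M.
    by case: k => // k _; exact: sl2_powE.
  split=> [|k /andP[k0 kq]]; rewrite psl_expg.
    apply/psl_eq; have [e0 [b eb]] := chebS_pred_order h.
    case: b eb => eb; [left|right]; apply/val_inj; rewrite /= powE // e0 eb scale0r sub0r.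
      by rewrite expr1 raddfN opprK.
    by rewrite expr0 opprK.
  (* As [S_k] does not vanish at the trace, a scalar [M^k] would make [M] scalar. But a scalar
     matrix of determinant 1 has trace 2 or -2. *)
  move=> /psl_eq hk.
  have hS : chebS k (\tr (sl2_mx M)) != 0.
    by rewrite (chebS_order_eq0 _ h) gtnNdvd.
  have [c hc] : exists c : R, sl2_mx M = c%:M.
    have [c hc] : exists c : R, sl2_mx (M ^+ k)%g = c%:M.
      case: hk => /(congr1 (@sl2_mx R)) hk; [exists 1|exists (-1)].
        exact: esym hk.
      by rewrite raddfN; apply: (canRL (@opprK _)); exact: esym hk.
    exists ((c + chebS k.-1 (\tr (sl2_mx M))) / chebS k (\tr (sl2_mx M))).
    rewrite -[LHS](scalerK hS) mulrC -scale_scalar_mx; congr (_ *: _).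
    by rewrite raddfD /= -hc powE // subrK.
  have := rational_angle_lt2 h; have := eqP (sl2_det M).
  rewrite hc mxtrace_scalar det_scalar mulr2n ltr_norml => c2 /andP[].
  by nra.
- by have /andP[_] := rational_angle_bounds h; apply: leq_trans.
Qed.

End Generation.

(** * Trace triples of the pairs obtained from [(A, B)] *)

Section Reached.
Variables (R : realType) (A B : PSL2 R).
Implicit Types (x y z : R) (t : triple R).

Definition reached t := exists M N : SL2 R, ext_nielsen A B (psl M) (psl N) /\
  t = (\tr (sl2_mx M), \tr (sl2_mx N), \tr (sl2_mx (M * N)%g)).

Lemma reached_start t : trace_triple A B t -> reached t.
Proof. by case=> M [N [hA hB ->]]; exists M, N; rewrite hA hB; split=> //; exact: en_refl. Qed.

Lemma reached_triple t : reached t -> exists U V,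
  [/\ ext_nielsen A B U V, trace_triple U V t & comm_tr U V = tau t].
Proof.
by case=> M [N [h ->]]; exists (psl M), (psl N); split; rewrite ?fricke //; exists M, N.
Qed.

Lemma reached_swap12 x y z : reached (x, y, z) -> reached (y, x, z).
Proof.
case=> M [N [h [-> -> ->]]]; exists N, M; split; first exact: en_swap.
by congr (_, _, _); exact: mxtrace_mulC.
Qed.

Lemma tr_sl2_inv (M : SL2 R) : \tr (sl2_mx M^-1%g) = \tr (sl2_mx M).
Proof. by rewrite sl2_invE linearB /= mxtrace_scalar mulr2n addrK. Qed.

Lemma reached_swap23 x y z : reached (x, y, z) -> reached (x, z, y).
Proof.
(* The product of the new pair is the conjugate [M^-1 N M], of trace [y]. *)
case=> M [N [h [-> -> ->]]]; exists M^-1%g, (N * M)%g; split.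
  have := en_inv (en_mul h).
  by rewrite -[(_ * _)%g]/(psl_mul _ _) psl_mulE -[(_^-1)%g]/(psl_inv _) psl_invE.
congr (_, _, _); first by rewrite tr_sl2_inv.
  exact: mxtrace_mulC.
rewrite -[RHS]/(\tr (sl2_mx M^-1%g *m (sl2_mx N *m sl2_mx M))) mxtrace_mulC.
rewrite -mulmxA -[sl2_mx M *m _]/(sl2_mx (M * M^-1)%g) mulgV.
by rewrite -[sl2_mx 1%g]/(1%:M : 'M[R]_2) mulmx1.
Qed.

Lemma reached_flip x y z : reached (x, y, z) -> reached (x, y, x * y - z).
Proof.
case=> M [N [h [-> -> ->]]]; exists M^-1%g, N; split.
  by have := en_inv h; rewrite -[(_^-1)%g]/(psl_inv _) psl_invE.
congr (_, _, _); first by rewrite tr_sl2_inv.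
rewrite -[sl2_mx (M^-1 * N)%g]/(sl2_mx M^-1%g *m sl2_mx N) sl2_invE.
by rewrite mulmxBl mul_scalar_mx linearB linearZ.
Qed.

Lemma psl_opp (M : SL2 R) : psl (sl2_opp M) = psl M.
Proof. by apply/psl_eq; right; rewrite sl2_oppK. Qed.

Lemma reached_neg13 x y z : reached (x, y, z) -> reached (- x, y, - z).
Proof.
case=> M [N [h [-> -> ->]]]; exists (sl2_opp M), N; rewrite psl_opp; split=> //.
congr (_, _, _); first by rewrite /= linearN.
by rewrite -[(_ * N)%g]/(sl2_mul _ _) sl2_mulNl /= linearN.
Qed.

Lemma reached_power x y z p q r s : is_rational_angle x p q -> 0 <= x ->
  (1 < p)%N -> (r * p = s * q + 1)%N -> reached (x, y, z) ->
  reached (x * chebS r x - 2 * chebS r.-1 x, y, chebS r x * z - chebS r.-1 x * y).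
Proof.
move=> hx x0 p1 e [M [N [h [ex ey ez]]]]; exists (M ^+ r)%g, N.
have r0 : (0 < r)%N by case: (r) e => //; rewrite mul0n addn1.
split; first by rewrite -psl_expg; apply: en_pow => //;
  apply: normalizing_power_psl e; rewrite -?ex.
have pE : sl2_mx (M ^+ r)%g = chebS r x *: sl2_mx M - (chebS r.-1 x)%:M.
  by rewrite -(prednK r0) sl2_powE -ex.
rewrite -[sl2_mx (M ^+ r * N)%g]/(sl2_mx (M ^+ r)%g *m sl2_mx N) pE mulmxBl.
rewrite -scalemxAl mul_scalar_mx.
have trB (a b : R) (X Y : 'M[R]_2) : \tr (a *: X - b *: Y) = a * \tr X - b * \tr Y.
  by rewrite linearB /= !linearZ.
rewrite -[(chebS r.-1 x)%:M]scalemx1 !trB mxtrace1 -ex -ey.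
rewrite -[sl2_mx M *m sl2_mx N]/(sl2_mx (M * N)%g) -ez; congr (_, _, _).
by rewrite (mulrC x) (mulrC 2).
Qed.

End Reached.

(** * Degrees of roots of unity *)

(** Each prime power [p^e] exactly dividing [m] is at most [2 totient (p^e) <= 2 k]. This turns a
    bound on the totient into a bound on [m]. *)
Lemma dvdn_totient_fact m k : (0 < m)%N -> (totient m <= k)%N -> (m %| (k.*2)`!)%N.
Proof.
move=> m0 mk; apply/(dvdn_partP _ m0) => p hp.
have pp : prime p by move: hp; rewrite mem_primes => /and3P[].
rewrite p_part; set e := logn p m.
have e0 : (0 < e)%N by rewrite logn_gt0.
apply: dvdn_fact; rewrite expn_gt0 prime_gt0 //=.
have hm : (totient (p ^ e) <= totient m)%N.
  rewrite -{1}(partnC p m0) p_part totient_coprime; last first.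
    by rewrite -p_part coprime_partC.
  by rewrite leq_pmulr // totient_gt0 part_gt0.
apply: (@leq_trans (totient (p ^ e)).*2); last by rewrite leq_double (leq_trans hm).
rewrite totient_pfactor // -[in X in (X <= _)%N](prednK e0) expnS doubleMl leq_mul2r.
by apply/orP; right; case: (p) pp => [|[|q]] //= _; rewrite -addnn addSnnS leq_addl.
Qed.

(** [X^m - 1] is the product of the ['Phi_d] with [d] dividing [m]. If [z] is a root of ['Phi_d],
    then [z^d = 1], which forces [d = m]. *)
Lemma root_Phi (F : fieldType) m (z : F) : m.-primitive_root z ->
  root (map_poly intr 'Phi_m) z.
Proof.
move=> hz; have m0 := prim_order_gt0 hz.
have XnE n : map_poly intr ('X^n - 1) = 'X^n - 1 :> {poly F}.
  by rewrite rmorphB /= map_polyXn rmorph1.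
have prodE n : (0 < n)%N ->
    \prod_(d <- divisors n) map_poly intr 'Phi_d = 'X^n - 1 :> {poly F}.
  by move=> n0; rewrite -XnE -(prod_Cyclotomic n0) rmorph_prod.
have /eqP : ('X^m - 1 : {poly F}).[z] = 0.
  by rewrite !hornerE (prim_expr_order hz) subrr.
rewrite -prodE // horner_prod prodf_seq_eq0 => /hasP[d hd /= rd].
suff -> : m = d by [].
move: hd; rewrite -dvdn_divisors // => dm; apply/eqP; rewrite eqn_dvd dm andbT.
have d0 : (0 < d)%N := dvdn_gt0 m0 dm.
rewrite (prim_order_dvd hz) -subr_eq0.
have -> : z ^+ d - 1 = ('X^d - 1 : {poly F}).[z] by rewrite !hornerE.
rewrite -prodE // horner_prod prodf_seq_eq0; apply/hasP; exists d => //.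
by rewrite -dvdn_divisors.
Qed.

(** The common root [z] makes the rational gcd of [P] and ['Phi_m] nonconstant. That gcd has a root
    in [algC], whose minimal polynomial is ['Phi_m] and therefore divides [P]. *)
Lemma totient_lt_size (F : numFieldType) m (z : F) (P : {poly rat}) : P != 0 ->
  m.-primitive_root z -> root (map_poly ratr P) z -> (totient m < size P)%N.
Proof.
move=> P0 hz hP; have m0 := prim_order_gt0 hz.
pose Phi : {poly rat} := map_poly intr 'Phi_m.
have PhiE (K : numFieldType) : map_poly ratr Phi = map_poly intr 'Phi_m :> {poly K}.
  by rewrite -map_poly_comp; apply: eq_map_poly => i /=; rewrite ratr_int.
have /closed_rootP[w] : size (map_poly ratr (gcdp P Phi) : {poly algC}) != 1%N.
  rewrite size_map_poly; apply: contraTneq hP => hg.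
  have : coprimep (map_poly ratr Phi : {poly F}) (map_poly ratr P).
    by rewrite coprimep_map coprimep_sym /coprimep hg.
  by move=> /coprimep_root; apply; rewrite PhiE root_Phi.
rewrite gcdp_map root_gcd PhiE => /andP[wP].
have [u hu] := C_prim_root_exists m0.
rewrite (Cintr_Cyclotomic hu) root_cyclotomic // => hw.
have [Q [hQ _] dQ] := minCpolyP w; move: wP; rewrite dQ => /(dvdp_leq P0).
by rewrite -(size_map_poly (@ratr algC)) -hQ (minCpoly_cyclotomic hw) size_cyclotomic.
Qed.

Section RationalEigenvalue.
Variables (F : numFieldType) (n : nat) (A : 'M[rat]_n.+1) (v : 'rV[F]_n.+1) (c : F).
Hypotheses (v0 : v != 0) (vA : v *m map_mx ratr A = c *: v).

Let horner_eigen (h : {poly rat}) :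
  v *m map_mx ratr (horner_mx A h) = (map_poly ratr h).[c] *: v.
Proof.
elim/poly_ind: h => [|h a IH]; first by rewrite !rmorph0 horner0 scale0r mulmx0.
rewrite !rmorphD !rmorphM /= horner_mx_X horner_mx_C map_polyX map_polyC.
rewrite -mulmxE mulmxDr mulmxA IH -scalemxAl vA !hornerE map_scalar_mx mul_mx_scalar.
by rewrite scalerA scalerDl.
Qed.

(* [z] is an eigenvalue of the rational block matrix [[0, -1], [1, h(A)]]. *)
Lemma primitive_root_order_bound (h : {poly rat}) (z : F) m :
  m.-primitive_root z -> z ^+ 2 - (map_poly ratr h).[c] * z + 1 = 0 ->
  (totient m <= n.+1 + n.+1)%N.
Proof.
move=> hz hq; set t := _.[c] in hq.
pose B : 'M[rat]_(n.+1 + n.+1) := block_mx 0 (-1) 1 (horner_mx A h).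
rewrite -ltnS -(size_char_poly B); apply: totient_lt_size hz _.
  by rewrite monic_neq0 // char_poly_monic.
rewrite map_char_poly -eigenvalue_root_char; apply/eigenvalueP.
(* The relation [z^2 = h(c) z - 1] is exactly what makes this an eigenvector for [z]. *)
exists (row_mx v (z *: v)).
  rewrite map_block_mx mul_row_block map_mx0 mulmx0 add0r map_mxN map_mx1.
  rewrite mulmxN !mulmx1 -scalemxAl horner_eigen -/t scale_row_mx; congr row_mx.
  rewrite !scalerA addrC -[X in _ - X]scale1r -scalerBl; congr (_ *: _).
  apply/eqP; rewrite -subr_eq0 -(oppr0 F) -hq; apply/eqP; ring.
apply: contra v0 => /eqP; rewrite -row_mx0 => /eq_row_mx[-> _].
exact: eqxx.
Qed.

End RationalEigenvalue.

(** * The ring Q[2 cos(pi/N)] and the rational angles in it *)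

Section CosineRing.
Variables (R : realType) (N : nat).
Implicit Types (x y : R) (p q : nat) (h : {poly rat}).

Definition cos_ring x :=
  exists h, x = (map_poly ratr h).[2 * cos (pi / N%:R)].

Lemma cos_ringB x y : cos_ring x -> cos_ring y -> cos_ring (x - y).
Proof. by move=> [h ->] [k ->]; exists (h - k); rewrite rmorphB hornerD hornerN. Qed.

Lemma cos_ringM x y : cos_ring x -> cos_ring y -> cos_ring (x * y).
Proof. by move=> [h ->] [k ->]; exists (h * k); rewrite rmorphM hornerM. Qed.

Lemma cos_ring1 : cos_ring 1.
Proof. by exists 1; rewrite rmorph1 hornerC. Qed.

Lemma cos_ring_gen : cos_ring (2 * cos (pi / N%:R)).
Proof. by exists 'X; rewrite map_polyX hornerX. Qed.

Lemma cos_ring_multiple k : cos_ring (2 * cos (k%:R * (pi / N%:R))).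
Proof.
set t := pi / _; have [m] := ubnP k; elim: m k => // m IH [|[|k]] hk.
- exists 2%:P; rewrite mul0r cos0 mulr1 map_polyC hornerC /=.
  by rewrite -[2]/(2%:R) ratr_nat.
- by rewrite mul1r; exact: cos_ring_gen.
have -> : 2 * cos (k.+2%:R * t) =
    2 * cos t * (2 * cos (k.+1%:R * t)) - 2 * cos (k%:R * t).
  have -> : k.+2%:R * t = k.+1%:R * t + t by rewrite -addn1 natrD; ring.
  have -> : k%:R * t = k.+1%:R * t - t by rewrite -[in RHS]addn1 natrD; ring.
  by rewrite cosB cosD; ring.
apply: cos_ringB; last by apply: IH; rewrite ltnS in hk; exact: ltnW.
by apply: cos_ringM; [exact: cos_ring_gen|apply: IH].
Qed.

Lemma cos_ring_rational_angle x p q : (0 < N)%N -> (q %| N)%N ->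
  is_rational_angle x p q -> cos_ring x.
Proof.
move=> N0 /dvdnP[k e] [q2 _ _ ->].
have -> : p%:R * pi / q%:R = (p * k)%:R * (pi / N%:R) :> R; last exact: cos_ring_multiple.
have k0 : k%:R != 0 :> R by rewrite pnatr_eq0; case: (k) e N0 => [->|//].
have q0 : q%:R != 0 :> R by rewrite pnatr_eq0; case: (q) q2.
by rewrite e !natrM; move: pi => w; field; rewrite ?k0 ?q0.
Qed.

Let cos_mod k : (0 < N)%N ->
  cos ((k %% N.*2)%:R * (pi / N%:R)) = cos (k%:R * (pi / N%:R)) :> R.
Proof.
move=> N0; have -> : k%:R * (pi / N%:R) =
    (k %% N.*2)%:R * (pi / N%:R) + (pi *+ 2) *+ (k %/ N.*2) :> R.
  rewrite -[X in _ = _ + X]mulr_natl -[pi *+ 2]mulr_natl {1}(divn_eq k N.*2).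
  rewrite natrD natrM -muln2 natrM; move: pi => w; field.
  by rewrite pnatr_eq0 -lt0n.
exact/esym/(periodicn (@cosD2pi R)).
Qed.

(** Take [z = exp (i t)] with [t = p pi / q]; it satisfies [z^(2 q) = 1], and [x] is the sum of [z]
    and its inverse. If [z] has order [m], then [sin (m t) = 0], so [q] divides [m]. *)
Lemma root_of_unity_angle x p q : is_rational_angle x p q ->
  exists m (z : R[i]), [/\ m.-primitive_root z, (q <= m)%N &
    z ^+ 2 - x%:C%C * z + 1 = 0].
Proof.
move=> hx; pose t : R := p%:R * pi / q%:R; pose z : R[i] := (cos t +i* sin t)%C.
have zX n : z ^+ n = (cos (n%:R * t) +i* sin (n%:R * t))%C.
  elim: n => [|n IH]; first by rewrite expr0 mul0r cos0 sin0.
  rewrite exprS IH -addn1 natrD mulrDl mul1r addrC cosD sinD.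
  by rewrite [LHS]/GRing.mul /=; congr (_ +i* _)%C; ring.
have q2 : (2 <= q)%N by case: hx.
have q0 : q%:R != 0 :> R by rewrite pnatr_eq0; case: (q) q2.
have [m hm _] : {m | m.-primitive_root z & (m %| q.*2)%N}.
  apply: prim_order_exists; first by rewrite double_gt0 ltnW.
  rewrite zX (_ : _ * t = (p.*2)%:R * pi); last first.
    by rewrite /t -!muln2 !natrM; move: pi => w; field.
  by rewrite cos_natpi sin_natpi -signr_odd odd_double.
exists m, z; split=> //.
- apply: dvdn_leq; first exact: prim_order_gt0 hm.
  rewrite -(chebS_order_eq0 _ hx); have s0 := rational_angle_sin_gt0 hx.
  have := prim_expr_order hm; rewrite zX => -[_ sm].
  case: hx => _ _ _ ->; rewrite -(inj_eq (mulIf (lt0r_neq0 s0))) mul0r chebS_sin.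
  by rewrite -/t sm.
- have -> : x = 2 * cos t by case: hx.
  rewrite zX /z; apply/eqP; rewrite eq_complex /=; have := cos2Dsin2 t.
  rewrite mulrDl mul1r cosD sinD => h; apply/andP; split; apply/eqP; last by ring.
  by transitivity (1 - (cos t ^+ 2 + sin t ^+ 2)); [ring|rewrite h subrr].
Qed.

(** A root of unity quadratic over the ring has an order [m] with [totient m <= 4 N], so [m] divides
    [(8 N)!], and [q <= m]. *)
Lemma cos_ring_denominators : (0 < N)%N -> exists B, forall x p q,
  cos_ring x -> is_rational_angle x p q -> (q <= B)%N.
Proof.
move=> N0; exists ((N.*2 + N.*2).*2)`! => x p q [h hx] hq.
have [m [z [hz qm hzx]]] := root_of_unity_angle hq.
apply: leq_trans qm _; apply: dvdn_leq; first exact: fact_gt0.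
apply: dvdn_totient_fact; first exact: prim_order_gt0 hz.
have [n hn] : exists n, N.*2 = n.+1 by exists N.*2.-1; rewrite prednK // double_gt0.
pose t : R := pi / N%:R.
have cos_ord k : cos ((k %% n.+1)%:R * t) = cos (k%:R * t).
  by rewrite -hn cos_mod.
(* Adjacency matrix of the cycle on [2 N] vertices. The vector of the [cos (j pi / N)] is an
   eigenvector for [2 cos (pi / N)], the neighbours of [j] contributing
   [cos ((j + 1) t) + cos ((j - 1) t)]. *)
pose A : 'M[rat]_n.+1 := \matrix_(i, j) ((i == ordS j)%:R + (i == ord_pred j)%:R).
pose v : 'rV[R[i]]_n.+1 := \row_j (cos (j%:R * t))%:C%C.
rewrite hn; apply: (@primitive_root_order_bound _ n A v ((2 * cos t)%:C)%C _ _ h z m hz).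
- apply/eqP => /rowP/(_ 0); rewrite !mxE mul0r cos0 => /eqP.
  by rewrite oner_eq0.
- apply/rowP => j; rewrite !mxE.
  under eq_bigr => i _ do rewrite !mxE rmorphD !rmorph_nat mulrDr.
  rewrite big_split /= (bigD1 (ordS j)) //= eqxx mulr1 big1 ?addr0; last first.
    by move=> i /negbTE->; rewrite mulr0.
  rewrite (bigD1 (ord_pred j)) //= eqxx mulr1 big1 ?addr0; last first.
    by move=> i /negbTE->; rewrite mulr0.
  rewrite !cos_ord -rmorphD -rmorphM; congr (_ %:C)%C.
  have -> : (j + n.+1).-1%:R * t = (j%:R * t - t) + pi *+ 2.
    have nt : n%:R * t = pi *+ 2 - t.
      have : n.+1%:R * t = pi *+ 2.
        rewrite -hn /t -muln2 natrM -mulr_natr; move: pi => w; field.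
        by rewrite pnatr_eq0 -lt0n.
      by rewrite -[n.+1]addn1 natrD mulrDl mul1r => <-; rewrite addrK.
    by rewrite addnS /= natrD mulrDl nt addrCA addrC addrA.
  rewrite cosD2pi -addn1 natrD mulrDl mul1r cosD cosB; ring.
rewrite -[RHS]hzx; congr (_ - _ * _ + _); rewrite hx -/t.
have -> : map_poly ratr h = map_poly (real_complex R) (map_poly ratr h) :> {poly R[i]}.
  by rewrite -map_poly_comp; apply: eq_map_poly => a /=; rewrite fmorph_rat.
by rewrite horner_map.
Qed.

End CosineRing.

(** * Sorting triples *)

(** Two adjacent transpositions generate all permutations of a triple. *)
Definition permutable (T : Type) (P : T * T * T -> Prop) :=
  (forall x y z, P (x, y, z) -> P (y, x, z)) /\
  (forall x y z, P (x, y, z) -> P (x, z, y)).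

Lemma sort3_ind (R : realType) (le : rel R) (P : triple R -> Prop) x y z :
  permutable P -> P (x, y, z) -> P (sort3 le (x, y, z)).
Proof.
case=> s12 s23 h; rewrite /sort3 /sort /=.
have h1 := s12 _ _ _ h; have h2 := s23 _ _ _ h; have h3 := s23 _ _ _ h1.
have h4 := s12 _ _ _ h2; have h5 := s12 _ _ _ h3.
by do 3 ?[case: ifP => _ /=].
Qed.

Lemma sort3_sorted (R : realType) (le : rel R) t : total le ->
  let: (x, y, z) := sort3 le t in le x y && le y z.
Proof.
case: t => [[x y] z] tot; rewrite /sort3.
have := sort_sorted tot [:: x; y; z]; have := size_sort le [:: x; y; z].
by case: (sort le _) => [|a [|b [|c [|]]]] //= _; rewrite andbT.
Qed.

Lemma sort3_id (R : realType) (le : rel R) x y z : transitive le ->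
  le x y -> le y z -> sort3 le (x, y, z) = (x, y, z).
Proof. by move=> tr xy yz; rewrite /sort3 sorted_sort //= xy yz. Qed.

Section Arrange.
Variable R : realType.
Implicit Types (x y z a b c u v w : R) (P : triple R -> Prop).

Definition switchable P := forall x y z, P (x, y, z) -> P (- x, y, - z).

Lemma switch_signs_ind P x y z : permutable P -> switchable P -> P (x, y, z) ->
  P (switch_signs (x, y, z)).
Proof.
case=> s12 s23 s h; rewrite /switch_signs; case: ifP => _; case: ifP => _ //.
- by rewrite -[z]opprK; exact/s/s12/s/s12.
- exact: s.
- exact/s12/s/s12.
Qed.

Lemma switch_signs_id x y z : 0 <= x -> 0 <= y -> switch_signs (x, y, z) = (x, y, z).
Proof. by move=> x0 y0; rewrite /switch_signs !ltNge x0 y0. Qed.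

Lemma switch_signsP x y z : exists z', switch_signs (x, y, z) = (`|x|, `|y|, z') /\
  `|z'| = `|z|.
Proof.
rewrite /switch_signs; case: ltP => hx; case: ltP => hy.
- by exists z; rewrite (ltr0_norm hx) (ltr0_norm hy).
- by exists (- z); rewrite (ltr0_norm hx) (ger0_norm hy) normrN.
- by exists (- z); rewrite (ltr0_norm hy) (ger0_norm hx) normrN.
- by exists z; rewrite (ger0_norm hx) (ger0_norm hy).
Qed.

Let le_norm : rel R := fun u v => `|u| <= `|v|.

Let le_norm_total : total le_norm. Proof. by move=> u v; exact: le_total. Qed.

Let le_norm_trans : transitive le_norm. Proof. by move=> u v w; exact: le_trans. Qed.

Lemma arrange_id x y z : 0 <= x -> x <= y -> y <= `|z| ->
  arrange (x, y, z) = (x, y, z).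
Proof.
move=> x0 xy yz; have y0 := le_trans x0 xy.
rewrite /arrange -/le_norm sort3_id ?switch_signs_id //.
  by rewrite /le_norm (ger0_norm x0) (ger0_norm y0).
by rewrite /le_norm (ger0_norm y0).
Qed.

Lemma arrange_ind P t : permutable P -> switchable P -> P t -> P (arrange t).
Proof.
case: t => [[a b] c] hp hs ht; rewrite /arrange.
have := sort3_ind le_norm hp ht; case: (sort3 _ _) => [[x y] z].
exact: switch_signs_ind.
Qed.

Definition abs_seq (t : triple R) := [:: `|t.1.1|; `|t.1.2|; `|t.2|].

Lemma arrangeP t : exists x y z, [/\ arrange t = (x, y, z),
  0 <= x, x <= y, y <= `|z| & perm_eq [:: x; y; `|z|] (abs_seq t)].
Proof.
have hp : permutable (fun s : triple R => perm_eq (abs_seq s) (abs_seq t)).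
  split=> x y z; apply: perm_trans; rewrite /abs_seq /=.
    exact: (permEl (perm_catCA [:: _] [:: _] [:: _])).
  by rewrite perm_cons; exact: (permEl (perm_catC [:: _] [:: _])).
have := @sort3_sorted R le_norm t le_norm_total.
have : perm_eq (abs_seq (sort3 le_norm t)) (abs_seq t).
  by case: (t) hp => [[a b] c] hp; apply: (sort3_ind le_norm hp).
rewrite /arrange -/le_norm; case: (sort3 _ _) => [[x y] z] h /andP[xy yz].
have [z' [-> e]] := switch_signsP x y z.
by exists `|x|, `|y|, z'; rewrite e; split.
Qed.

(** Permutations and double sign switches keep the product; it recovers the sign of the last entry,
    which [arrangeP] leaves open. *)
Lemma arrange_prod a b c x y z : arrange (a, b, c) = (x, y, z) ->
  x * y * z = a * b * c.
Proof.
move=> e; pose P (t : triple R) := t.1.1 * t.1.2 * t.2 = a * b * c.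
suff : P (arrange (a, b, c)) by rewrite e.
apply: arrange_ind => //; rewrite /P /=.
  by split=> u v w /= <-; ring.
by move=> u v w /= <-; ring.
Qed.

Lemma arrange_eq t u v w : 0 <= u -> u <= v -> v <= w ->
  perm_eq (abs_seq t) [:: u; v; w] ->
  exists z, arrange t = (u, v, z) /\ `|z| = w.
Proof.
move=> u0 uv vw hp; have [x [y [z [e x0 xy yz hp']]]] := arrangeP t.
have : [:: x; y; `|z|] = [:: u; v; w].
  apply: (sorted_eq le_trans le_anti); first by rewrite /= xy yz.
    by rewrite /= uv vw.
  exact: perm_trans hp' hp.
by move=> [ex ey hz]; exists z; rewrite -hz e ex ey.
Qed.

End Arrange.

(** * Steps of the algorithm *)

Section TauIdentities.
Variable R : realType.
Implicit Types (x y z : R).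

Lemma tau_swap12 x y z : tau (y, x, z) = tau (x, y, z).
Proof. by rewrite /tau; ring. Qed.

Lemma tau_swap23 x y z : tau (x, z, y) = tau (x, y, z).
Proof. by rewrite /tau; ring. Qed.

Lemma tau_switch x y z : tau (- x, y, - z) = tau (x, y, z).
Proof. by rewrite /tau; ring. Qed.

Lemma tau_flip x y z : tau (x, y, x * y - z) = tau (x, y, z).
Proof. by rewrite /tau; ring. Qed.

(** The left side is the determinant of [S_{n+1}(x) M - S_n(x)], a power of a matrix [M] of
    determinant 1 and trace [x]. *)
Lemma chebS_det x n :
  chebS n.+1 x ^+ 2 + chebS n x ^+ 2 - x * chebS n.+1 x * chebS n x = 1.
Proof.
elim: n => [|n IH]; first by rewrite /=; ring.
rewrite -[RHS]IH -[chebS n.+2 x]/(x * chebS n.+1 x - chebS n x); ring.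
Qed.

(** [2 - tau] is the determinant of [M N - N M], and replacing [M] by [s M - s'] multiplies this
    commutator by [s]. *)
Lemma tau_power x y z r : (0 < r)%N ->
  tau (x * chebS r x - 2 * chebS r.-1 x, y, chebS r x * z - chebS r.-1 x * y) - 2 =
  chebS r x ^+ 2 * (tau (x, y, z) - 2).
Proof.
case: r => // n _; have := chebS_det x n; rewrite [n.+1.-1]/=.
move: (chebS n.+1 x) (chebS n x) => s s' d.
apply/eqP; rewrite -subr_eq0; apply/eqP.
transitivity ((4 - y ^+ 2) * (s ^+ 2 + s' ^+ 2 - x * s * s' - 1)).
  by rewrite /tau; ring.
by rewrite d subrr mulr0.
Qed.

End TauIdentities.

Section Algorithm.
Variables (R : realType) (A B : PSL2 R).
Implicit Types (x y z e : R) (t : triple R) (S : R -> Prop).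

Definition answer (out : triple R) :=
  exists (x y z : R) (U V : PSL2 R),
    (x, y, z) = in_order out /\
    trace_triple U V (x, y, z) /\
    ext_nielsen A B U V /\
    (0 <= x /\ x <= y) /\
    (2 <= y -> z <= -2) /\
    (exists p : nat,
      ((2 <= p)%N /\ x = 2 * cos (pi / p%:R)) /\
      (y < 2 -> exists q : nat, (p <= q)%N /\ y = 2 * cos (pi / q%:R))) /\
    (y < 2 ->
       z <= -2 \/
       (y <= `|z| /\
        exists r s : nat,
          [/\ (2 <= s)%N, (1 <= r <= s - 1)%N, coprime r s &
              `|z| = 2 * cos (r%:R * pi / s%:R)])) /\
    (2 < comm_tr U V /\ comm_tr U V <= comm_tr A B).

(** Termination and correctness in one predicate, which [halts_step] pulls back along a step. The
    lemmas below follow the algorithm backwards, taking the continuations of each step as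
    hypotheses. *)
Definition halts (st : state R) := exists n o, iter n (@etma_step R) st = Stop o /\
  (o = NotDiscrete \/ exists out, o = Triple out /\ answer out).

Lemma halts_step st : halts (etma_step st) -> halts st.
Proof. by case=> n [u [h hu]]; exists n.+1, u; rewrite iterSr. Qed.

Lemma halts_not_discrete : halts (Stop (@NotDiscrete R)).
Proof. by exists 0%N, (@NotDiscrete R); split=> //; left. Qed.

Lemma halts_triple t : answer t -> halts (Stop (Triple t)).
Proof. by move=> h; exists 0%N, (Triple t); split=> //; right; exists t. Qed.

Definition angle x := exists p q, is_rational_angle x p q.

Lemma normalized_is_angle x : normalized x -> angle x.
Proof. by case=> q q2 h; exists 1%N, q; exact: normalized_angle. Qed.

Lemma rat_angle_eq0 x : ~ angle x -> rat_angle x == (0%N, 0%N).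
Proof. by move=> h; apply/negPn/negP => /rat_angleP hx; apply: h; eexists; eexists; exact: hx. Qed.

Lemma rat_angle_neq0 x : angle x -> rat_angle x == (0%N, 0%N) = false.
Proof.
by case=> p [q h]; rewrite (rat_angle_eq h) xpair_eqE; case: h; case: q => // q; rewrite andbF.
Qed.

Lemma angle_normalized x : angle x -> ~~ (1 < (rat_angle x).1)%N -> normalized x.
Proof.
case=> p [q h]; rewrite (rat_angle_eq h) /= -leqNgt => p1.
have /andP[p0 _] := rational_angle_bounds h.
have ep : p = 1%N by apply/eqP; rewrite eqn_leq p1.
by case: h => q2 _ _ ->; exists q => //; rewrite ep mul1r.
Qed.

Lemma rat_angle_normalized x : normalized x -> (rat_angle x).1 = 1%N.
Proof. by case=> q q2 h; rewrite (rat_angle_eq (normalized_angle q2 h)). Qed.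

Definition subring_pred S :=
  [/\ S 1, forall x y, S x -> S y -> S (x - y) & forall x y, S x -> S y -> S (x * y)].

(* [S] bounds the field of definition of the traces and [e] the commutator
   trace. *)
Definition admissible S e t :=
  [/\ reached A B t, [/\ S t.1.1, S t.1.2 & S t.2],
      2 < tau t, tau t <= comm_tr A B & tau t < e].

Lemma inv_lt S e e' t : e <= e' -> admissible S e t -> admissible S e' t.
Proof. by move=> h [? ? ? ? ht]; split=> //; exact: lt_le_trans h. Qed.

Section Invariants.
Variable S : R -> Prop.
Hypothesis HS : subring_pred S.

Lemma subring_opp x : S x -> S (- x).
Proof.
case: HS => S1 SB SM Sx; have S0 : S 0 by rewrite -(subrr 1); exact: SB.
by rewrite -sub0r; exact: SB.
Qed.

Lemma subring_chebS n x : S x -> S (chebS n x).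
Proof.
case: HS => S1 SB SM Sx; have S0 : S 0 by rewrite -(subrr 1); exact: SB.
have [m] := ubnP n; elim: m n => // m IH [|[|n]] hn //.
rewrite -[chebS n.+2 x]/(x * chebS n.+1 x - chebS n x); apply: SB.
  by apply: SM => //; apply: (IH n.+1).
by apply: IH; rewrite ltnS in hn; exact: ltnW.
Qed.

Lemma inv_permutable e : permutable (admissible S e).
Proof.
split=> x y z [h1 [h2 h3 h4] h5 h6 h7]; split=> //.
- exact: reached_swap12.
- by rewrite tau_swap12.
- by rewrite tau_swap12.
- by rewrite tau_swap12.
- exact: reached_swap23.
- by rewrite tau_swap23.
- by rewrite tau_swap23.
- by rewrite tau_swap23.
Qed.

Lemma inv_switchable e : switchable (admissible S e).
Proof.
move=> x y z [h1 [h2 h3 h4] h5 h6 h7]; split; rewrite 1?tau_switch //.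
  exact: reached_neg13.
by split=> //; exact: subring_opp.
Qed.

Lemma inv_flip e x y z : admissible S e (x, y, z) -> admissible S e (x, y, x * y - z).
Proof.
case=> h1 [h2 h3 h4] h5 h6 h7; split; rewrite 1?tau_flip //.
  exact: reached_flip.
by case: HS => _ SB SM; split=> //=; apply: SB => //; exact: SM.
Qed.

Lemma inv_switch e x y z : admissible S e (x, y, z) -> admissible S e (switch_signs (x, y, z)).
Proof. exact: switch_signs_ind (inv_permutable e) (inv_switchable (e := e)). Qed.

Lemma inv_arrange e t : admissible S e t -> admissible S e (arrange t).
Proof. exact: arrange_ind (inv_permutable e) (inv_switchable (e := e)). Qed.

(** The new bound is the old value of [tau], so that the strict decrease is recorded in the index of
    [admissible]. *)
Lemma inv_power e x y z : angle x -> 0 <= x -> (1 < (rat_angle x).1)%N ->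
  let r := norm_exp x in
  admissible S e (x, y, z) -> normalized `|x * chebS r x - 2 * chebS r.-1 x| /\
  admissible S (tau (x, y, z))
   (x * chebS r x - 2 * chebS r.-1 x, y, chebS r x * z - chebS r.-1 x * y).
Proof.
move=> [p [q hx]] x0; rewrite (rat_angle_eq hx) => p1 r.
have [/andP[r0 _] [s hr]] := norm_exp_spec (rat_angle_eq hx) p1.
case=> h1 [h2 h3 h4] h5 h6 h7; split; first exact: power_normalized hx hr.
have ht := tau_power x y z r0.
have s0 := chebS_power_gt0 hx hr; have s1 := chebS_power_lt1 hx hr x0 p1.
rewrite -/r in ht; set t' := tau _ in ht.
have [c1 c2] : 2 < t' /\ t' < tau (x, y, z).
  by move: ht s0 s1; move: (_ ^+ 2) => w ht w0 w1; split; nra.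
split=> //.
- exact: reached_power hx x0 p1 hr h1.
- case: HS => S1 SB SM; have S2 : S 2.
    by rewrite (_ : 2 = 1 - - 1); [apply: SB => //; exact: subring_opp|ring].
  by split=> //=; apply: SB; apply: SM => //; exact: subring_chebS.
- by rewrite (le_trans (ltW c2)).
Qed.

Lemma halts_At3 e x y z : 0 <= x < 2 -> 0 <= y -> admissible S e (x, y, z) ->
  (normalized x -> halts (At 5 (x, y, z))) ->
  (forall x' z', angle x -> (1 < (rat_angle x).1)%N -> normalized x' ->
    admissible S (tau (x, y, z)) (x', y, z') -> halts (At 5 (x', y, z'))) ->
  halts (At 3 (x, y, z)).
Proof.
move=> xr y0 hi H1 H2; apply: halts_step; rewrite /etma_step xr /=.
have [hx|hx] := pselect (angle x); last first.
  by rewrite rat_angle_eq0 //; exact: halts_not_discrete.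
rewrite rat_angle_neq0 //; apply: halts_step; rewrite /etma_step.
have x0 : 0 <= x by case/andP: xr.
case: ifP => hp; last by apply: H1; apply: angle_normalized; rewrite ?hp.
have [nx hi'] := inv_power hx x0 hp hi; move: nx (inv_switch hi').
set X := (X in switch_signs (X, _, _)); set Z := (X in switch_signs (_, _, X)).
have [z' [-> _]] := switch_signsP X y Z; rewrite (ger0_norm y0).
exact: H2.
Qed.

Lemma halts_At7 e x y z : 0 <= x -> 0 <= y < 2 -> admissible S e (x, y, z) ->
  (normalized y -> halts (At 9 (x, y, z))) ->
  (forall y' z', angle y -> (1 < (rat_angle y).1)%N -> normalized y' ->
    admissible S (tau (x, y, z)) (x, y', z') -> halts (At 9 (x, y', z'))) ->
  halts (At 7 (x, y, z)).
Proof.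
move=> x0 yr hi H1 H2; apply: halts_step; rewrite /etma_step yr /=.
have [hy|hy] := pselect (angle y); last first.
  by rewrite rat_angle_eq0 //; exact: halts_not_discrete.
rewrite rat_angle_neq0 //; apply: halts_step; rewrite /etma_step.
have y0 : 0 <= y by case/andP: yr.
case: ifP => hp; last by apply: H1; apply: angle_normalized; rewrite ?hp.
have [ny] := inv_power hy y0 hp ((inv_permutable e).1 _ _ _ hi).
rewrite tau_swap12 => /(inv_permutable _).1 hi'; move: ny (inv_switch hi').
set Y := (X in switch_signs (_, X, _)); set Z := (X in switch_signs (_, _, X)).
have [z' [-> _]] := switch_signsP x Y Z; rewrite (ger0_norm x0).
exact: H2.
Qed.

Lemma halts_At5_ordered x y z : y <= `|z| -> halts (At 6 (x, y, z)) -> halts (At 5 (x, y, z)).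
Proof. by move=> h ?; apply: halts_step; rewrite /etma_step ltNge h. Qed.

Lemma halts_At5 e x y z : 0 <= x -> 0 <= y -> admissible S e (x, y, z) ->
  (forall y' z', admissible S e (x, y', z') -> 0 <= y' -> y' <= y -> y' <= `|z'| ->
    halts (At 6 (x, y', z'))) ->
  halts (At 5 (x, y, z)).
Proof.
move=> x0 y0 hi H; have [h|h] := leP y `|z|.
  by apply: halts_At5_ordered => //; exact: H.
apply: halts_step; rewrite /etma_step h.
have := inv_switch ((inv_permutable e).2 _ _ _ hi).
have [z' [-> hz]] := switch_signsP x z y; rewrite (ger0_norm x0) => hi'.
by apply: H => //; [exact: ltW|rewrite hz (ger0_norm y0) ltW].
Qed.

Lemma answerI e out x y z : in_order out = (x, y, z) -> admissible S e (x, y, z) ->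
  normalized x -> x <= y -> (y < 2 -> normalized y) -> (2 <= y -> z <= -2) ->
  (y < 2 -> z <= -2 \/ y <= `|z| /\ angle `|z|) -> answer out.
Proof.
move=> ho [hr _ h1 h2 _] nx xy ny y2 yz.
have [U [V [hU hV hc]]] := reached_triple hr.
have /andP[x0 _] := normalized_range nx.
exists x, y, z, U, V; rewrite ho hc.
split=> //; split=> //; split=> //; split=> //; split=> //; split; last split=> //.
  case: (nx) => p p2 hp; exists p; split=> // /ny[q q2 hq]; exists q; split=> //.
  by apply: (@normalized_le R) => //; rewrite -hp -hq.
Qed.

Lemma halts_At6 e x y z : normalized x -> 0 <= y -> y <= `|z| -> admissible S e (x, y, z) ->
  (2 <= y -> 2 <= z -> halts (At 2 (x, y, x * y - z))) ->
  (y < 2 -> halts (At 7 (x, y, z))) ->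
  halts (At 6 (x, y, z)).
Proof.
move=> nx y0 yz hi K0 K7; have /andP[x0 x2] := normalized_range nx.
apply: halts_step; rewrite /etma_step switch_signs_id //.
case: ifP => [/andP[y2 z2]|h1]; first exact: K0.
case: ifP => [/andP[y2 z2]|h2].
  apply/halts_triple/(@answerI e _ x y z) => //.
  - by rewrite /in_order ltNge yz.
  - by rewrite (le_trans (ltW x2)).
  - by rewrite ltNge y2.
  - by rewrite ltNge y2.
(* If [|z| >= y >= 2], one of the two exits of step 6 has been taken already. *)
apply: K7; rewrite ltNge; apply/negP => y2; move: h1 h2; rewrite y2 /=.
by have := le_trans y2 yz; rewrite ler_normr lerNr => /orP[->|->].
Qed.

Lemma halts_At10 e x y z : normalized x -> normalized y -> x <= y -> admissible S e (x, y, z) ->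
  (2 <= z -> halts (At 2 (x, y, x * y - z))) ->
  (angle `|z| -> `|z| < y -> halts (At 2 (x, y, z))) ->
  halts (At 10 (x, y, z)).
Proof.
move=> nx ny xy hi K1 K2; have /andP[x0 x2] := normalized_range nx.
have /andP[y0 y2] := normalized_range ny.
have done11 : (y < 2 -> z <= -2 \/ y <= `|z| /\ angle `|z|) ->
    y <= `|z| -> halts (At 11 (x, y, z)).
  move=> H h; apply/halts_step/halts_triple/(@answerI e _ x y z) => //.
    by rewrite /in_order ltNge h.
  by rewrite leNgt y2.
apply: halts_step; rewrite /etma_step switch_signs_id //.
case: ifP => [|z2]; first exact: K1.
case: ifP => [zn2|/negbT]; last first.
  rewrite -leNgt => zn2; apply: done11; last by rewrite (le_trans (ltW y2)).
  by move: zn2; rewrite ler_normr z2 /= lerNr; left.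
have [hz|hz] := pselect (angle `|z|); last first.
  by rewrite rat_angle_eq0 //; exact: halts_not_discrete.
rewrite rat_angle_neq0 //; have [yz|yz] := leP y `|z|.
  by rewrite andbF; apply: done11 => // _; right.
rewrite andbT; case: ifP => hp; first exact: K2.
have nz := angle_normalized hz (negbT hp).
apply/halts_step/halts_triple.
(* The exceptional output with [|z| < y]: the three absolute values are all normalized, so every
   arrangement of them meets the conditions. *)
have [a [b [c [harr a0 ab bc hperm]]]] := arrangeP (x, y, z).
have hn u : u \in [:: a; b; `|c|] -> normalized u.
  rewrite (perm_mem hperm) /abs_seq /= (ger0_norm x0) (ger0_norm y0) !inE.
  by move=> /or3P[] /eqP->.
have nb : normalized b by apply: hn; rewrite !inE eqxx orbT.
have /andP[b0 b2] := normalized_range nb.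
apply: (@answerI e _ a b c) => //.
- by rewrite /in_order yz.
- by rewrite -harr; exact: inv_arrange.
- by apply: hn; rewrite !inE eqxx.
- by rewrite leNgt b2.
- move=> _; right; split=> //; apply/normalized_is_angle/hn.
  by rewrite !inE eqxx !orbT.
Qed.

(** This and [angles_halt] cover the two ways back from step 10 to step 2. They are assumed below a
    bound [e] on [tau], which is the form of an induction hypothesis. *)
Definition flip_halts e := forall x y z, admissible S e (x, y, z) -> normalized x ->
  normalized y -> x <= y -> 2 <= z -> halts (At 2 (x, y, x * y - z)).

Definition angles_halt e := forall x y z, admissible S e (x, y, z) -> angle `|x| ->
  angle `|y| -> angle `|z| -> halts (At 2 (x, y, z)).

Lemma normalized_norm x : normalized x -> `|x| = x.
Proof. by move=> /normalized_range/andP[/ger0_norm]. Qed.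

Lemma halts_At9 e x y z : flip_halts e -> angles_halt e -> normalized x -> normalized y ->
  admissible S e (x, y, z) -> halts (At 9 (x, y, z)).
Proof.
move=> K1 K2 nx ny hi; have /andP[x0 x2] := normalized_range nx.
have /andP[y0 y2] := normalized_range ny.
have H a b : normalized a -> normalized b -> a <= b -> admissible S e (a, b, z) ->
    halts (At 10 (a, b, z)).
  move=> na nb ab hab; apply: (halts_At10 na nb ab hab) => [|hz _]; first exact: K1.
  by apply: K2 => //; rewrite normalized_norm //; exact: normalized_is_angle.
apply: halts_step; rewrite /etma_step switch_signs_id //; case: ltP => h.
  by apply: H => //; [exact: ltW|exact: (inv_permutable e).1].
exact: H.
Qed.

Lemma halts_round_At7 e x y z : flip_halts e -> angles_halt e -> normalized x ->
  0 <= y < 2 -> admissible S e (x, y, z) -> halts (At 7 (x, y, z)).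
Proof.
move=> K1 K2 nx yr hi; have /andP[x0 x2] := normalized_range nx.
apply: (halts_At7 x0 yr hi) => [ny|y' z' _ _ ny hi']; apply: (halts_At9 K1 K2) => //.
by apply: inv_lt hi'; case: hi => _ _ _ _ /ltW.
Qed.

Lemma halts_round_At5 e x y z : flip_halts e -> angles_halt e -> normalized x ->
  0 <= y -> admissible S e (x, y, z) ->
  (2 <= y -> forall y' z', admissible S e (x, y', z') -> 2 <= y' -> y' <= z' ->
    halts (At 2 (x, y', x * y' - z'))) ->
  halts (At 5 (x, y, z)).
Proof.
move=> K1 K2 nx y0 hi K0; have /andP[x0 x2] := normalized_range nx.
apply: (halts_At5 x0 y0 hi) => y' z' hi' y'0 y'y y'z'.
apply: (halts_At6 nx y'0 y'z' hi') => [y2 z2|y2].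
  apply: K0 => //; first exact: le_trans y'y.
  by move: y'z'; rewrite ger0_norm // (le_trans _ z2).
by apply: (halts_round_At7 K1 K2) => //; rewrite y'0 y2.
Qed.

(** One round starting at step 2. The only return not covered by the two assumptions is the one from
    step 6, which needs [y >= 2]. *)
Lemma halts_round_At2 e t x y z : flip_halts e -> angles_halt e ->
  arrange t = (x, y, z) -> x < 2 -> admissible S e t ->
  (2 <= y -> forall x' y' z', admissible S e (x', y', z') -> normalized x' ->
    2 <= y' -> y' <= z' -> halts (At 2 (x', y', x' * y' - z'))) ->
  halts (At 2 t).
Proof.
move=> K1 K2 ht x2 hi K0.
have [a [b [c [harr a0 ab bc _]]]] := arrangeP t.
move: harr a0 ab bc; rewrite ht => -[<- <- <-] x0 xy yz.
have hi' : admissible S e (x, y, z) by rewrite -ht; exact: inv_arrange.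
have y0 := le_trans x0 xy.
apply: halts_step; rewrite /etma_step ht.
apply: (halts_At3 _ y0 hi') => [|nx|x' z' _ _ nx hi'']; first by rewrite x0 x2.
  by apply: (halts_round_At5 K1 K2 nx y0 hi') => y2 y' z' h1 h2 h3; exact: K0.
have {}hi'' : admissible S e (x', y, z').
  by apply: inv_lt hi''; case: hi' => _ _ _ _ /ltW.
by apply: (halts_round_At5 K1 K2 nx y0 hi'') => y2 y' z1 h1 h2 h3; exact: K0.
Qed.

Lemma halts_At3_normalized e x y z : normalized x -> 0 <= y -> admissible S e (x, y, z) ->
  halts (At 5 (x, y, z)) -> halts (At 3 (x, y, z)).
Proof.
move=> nx y0 hi H; apply: (halts_At3 _ y0 hi) => //; first exact: normalized_range.
by move=> x' z' _; rewrite rat_angle_normalized.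
Qed.

Lemma halts_At7_normalized e x y z : 0 <= x -> normalized y -> admissible S e (x, y, z) ->
  x <= y -> halts (At 10 (x, y, z)) -> halts (At 7 (x, y, z)).
Proof.
move=> x0 ny hi xy H; apply: (halts_At7 x0 _ hi); first exact: normalized_range.
  by move=> _; apply: halts_step; rewrite /etma_step ltNge xy.
by move=> x' z' _; rewrite rat_angle_normalized.
Qed.

(** Only the new entry [w] can fail to be an angle. If [|w|] is not one, it is met by an angle
    recovery, which then fails, unless [w <= -2] and the triple is returned. The other two entries
    are normalized, so nothing changes before. *)
Lemma angles_flip e : angles_halt e -> flip_halts e.
Proof.
move=> K2 x y z hi nx ny xy z2; set w := x * y - z.
have {}hi : admissible S e (x, y, w) := inv_flip hi.
have /andP[x0 x2] := normalized_range nx.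
have /andP[y0 y2] := normalized_range ny.
have w2 : w < 2 by rewrite /w; nra.
have [hw|hw] := pselect (angle `|w|).
  by apply: K2 => //; rewrite normalized_norm //; exact: normalized_is_angle.
have hS : abs_seq (x, y, w) = [:: x; y; `|w|].
  by rewrite /abs_seq /= (normalized_norm nx) (normalized_norm ny).
have w0 := normr_ge0 w; have hi' := inv_arrange hi.
have [wx|xw] := ltP `|w| x.
  have [c [harr hc]] : exists c, arrange (x, y, w) = (`|w|, x, c) /\ `|c| = y.
    by apply: arrange_eq => //; rewrite ?hS ?ltW // (permEl (perm_catC [:: x; y] [:: `|w|])).
  apply: halts_step; rewrite /etma_step harr; rewrite harr in hi'.
  apply: (halts_At3 _ x0 hi'); first by rewrite w0 (lt_trans wx).
    by move=> /normalized_is_angle.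
  by move=> x' z' /hw.
have [wy|yw] := ltP `|w| y.
  have [c [harr hc]] : exists c, arrange (x, y, w) = (x, `|w|, c) /\ `|c| = y.
    apply: arrange_eq => //; first exact: ltW.
    by rewrite hS perm_cons (permEl (perm_catC [:: y] [:: `|w|])).
  apply: halts_step; rewrite /etma_step harr; rewrite harr in hi'.
  apply: (halts_At3_normalized nx w0 hi'); apply: halts_At5_ordered; first by rewrite hc ltW.
  apply: (halts_At6 nx w0 _ hi') => [|h2|h2]; first by rewrite hc ltW.
    by move: (lt_trans wy y2); rewrite ltNge h2.
  apply: (halts_At7 x0 _ hi'); first by rewrite w0 h2.
    by move=> /normalized_is_angle.
  by move=> y' z' /hw.
apply: halts_step; rewrite /etma_step arrange_id //.
apply: (halts_At3_normalized nx y0 hi); apply: halts_At5_ordered => //.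
apply: (halts_At6 nx y0 yw hi) => [|_]; first by rewrite leNgt y2.
apply: (halts_At7_normalized x0 ny hi xy).
by apply: (halts_At10 nx ny xy hi) => [|/hw //]; rewrite leNgt w2.
Qed.

(* The pair (y, |z|) shrinks by a definite amount while [x] stays fixed. *)
Lemma halts_large_pair e x y z : flip_halts e -> angles_halt e -> admissible S e (x, y, z) ->
  normalized x -> 2 <= y -> y <= z -> halts (At 2 (x, y, x * y - z)).
Proof.
move=> K1 K2 hi nx; have /andP[x0 x2] := normalized_range nx.
have d0 : 0 < 2 * (2 - x) by lra.
have [n hn] : exists n : nat, y + z < n%:R * (2 * (2 - x)).
  exists (Num.bound `|(y + z) / (2 * (2 - x))|).
  by rewrite -ltr_pdivrMr // (le_lt_trans (ler_norm _)) // archi_boundP.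
elim: n y z hi hn => [|n IH] y z hi hn y2 yz; first by lra.
set w := x * y - z; have {}hi : admissible S e (x, y, w) := inv_flip hi.
have xy : x <= y by lra.
have y0 : 0 <= y by lra.
have hS : abs_seq (x, y, w) = [:: x; y; `|w|].
  by rewrite /abs_seq /= normalized_norm // ger0_norm.
have w0 := normr_ge0 w; have hi' := inv_arrange hi.
(* If [|w| < 2], then [y] becomes the last entry, the second one is below 2, and step 6 cannot
   return. *)
have [w2|w2] := ltP `|w| 2.
  have [wx|xw] := ltP `|w| x.
    have [c [harr _]] : exists c, arrange (x, y, w) = (`|w|, x, c) /\ `|c| = y.
      by apply: arrange_eq => //; rewrite ?hS ?ltW // (permEl (perm_catC [:: x; y] [:: `|w|])).
    by apply: (halts_round_At2 K1 K2 harr w2 hi); rewrite leNgt x2.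
  have [c [harr _]] : exists c, arrange (x, y, w) = (x, `|w|, c) /\ `|c| = y.
    apply: arrange_eq => //; first by lra.
    by rewrite hS perm_cons (permEl (perm_catC [:: y] [:: `|w|])).
  by apply: (halts_round_At2 K1 K2 harr x2 hi); rewrite leNgt w2.
(* The decrease is [z - w = 2 z - x y >= z (2 - x) >= 2 (2 - x)]. *)
have dec a b : 0 < w -> a + b = y + w -> a + b < n%:R * (2 * (2 - x)).
  by move=> wp ->; move: hn; rewrite -addn1 natrD mulrDl mul1r /w; nra.
have [wy|yw] := ltP `|w| y.
  have [c [harr hc]] : exists c, arrange (x, y, w) = (x, `|w|, c) /\ `|c| = y.
    apply: arrange_eq => //; [lra|exact: ltW|].
    by rewrite hS perm_cons (permEl (perm_catC [:: y] [:: `|w|])).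
  have hp := arrange_prod harr.
  apply: halts_step; rewrite /etma_step harr; rewrite harr in hi'.
  apply: (halts_At3_normalized nx w0 hi'); apply: halts_At5_ordered; first by rewrite hc ltW.
  apply: (halts_At6 nx w0 _ hi') => [|_ c2|h2]; first by rewrite hc ltW.
    have hcy : c = y by rewrite -hc ger0_norm // (le_trans _ c2).
    (* The arranged triple has positive entries and product [x y w]. Here [x = 0] is excluded, as it
       would give [|w| = z >= y]. *)
    have wp : 0 < w.
      have xp : 0 < x.
        rewrite lt_neqAle x0 andbT; apply: contraTneq wy => ex.
        by rewrite -leNgt /w -ex mul0r sub0r normrN ger0_norm //; lra.
      rewrite ltNge; apply/negP => wn; move: hp w2.
      rewrite hcy (ler0_norm wn) => hp w2.
      have xy0 : 0 < x * y by apply: mulr_gt0 => //; lra.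
      nra.
    apply: IH => //; first by apply: dec; rewrite ?hcy ?(gtr0_norm wp) // addrC.
    by rewrite hcy ltW.
  by move: w2; rewrite leNgt h2.
apply: halts_step; rewrite /etma_step arrange_id //.
apply: (halts_At3_normalized nx y0 hi); apply: halts_At5_ordered => //.
apply: (halts_At6 nx y0 yw hi) => [_ wp|h2]; last by move: y2; rewrite leNgt h2.
have wp' : 0 < w by lra.
by apply: IH => //; [exact: dec|move: yw; rewrite gtr0_norm].
Qed.

(** If neither of the first two arranged entries needs a proper normalization, then [|c| < 2] and
    [b <= |c|] prevent any return from step 10. Otherwise [tau] drops, and the hypothesis at the
    bound [tau (x, y, z)] takes over. *)
Lemma halts_angles_step e x y z : admissible S e (x, y, z) -> angle `|x| -> angle `|y| ->
  angle `|z| -> angles_halt (tau (x, y, z)) -> halts (At 2 (x, y, z)).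
Proof.
move=> hi hx hy hz K2; have K1 := angles_flip K2.
have [a [b [c [harr a0 ab bc hperm]]]] := arrangeP (x, y, z).
have hn u : u \in [:: a; b; `|c|] -> angle u /\ u < 2.
  rewrite (perm_mem hperm) /abs_seq /= !inE.
  move=> hu; have {}hu : angle u by case/or3P: hu => /eqP->.
  by split=> //; case: hu => p [q /rational_angle_lt2]; apply: le_lt_trans (ler_norm u).
have [_ a2] : angle a /\ a < 2 by apply: hn; rewrite !inE eqxx.
have [_ b2] : angle b /\ b < 2 by apply: hn; rewrite !inE eqxx orbT.
have [hc c2] : angle `|c| /\ `|c| < 2 by apply: hn; rewrite !inE eqxx !orbT.
have ht : tau (a, b, c) = tau (x, y, z).
  pose P (t : triple R) := tau t = tau (x, y, z).
  have : P (arrange (x, y, z)).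
    apply: arrange_ind => //; rewrite /P.
      by split=> ? ? ? <-; [exact: tau_swap12|exact: tau_swap23].
    by move=> ? ? ? <-; rewrite tau_switch.
  by rewrite harr.
have hi' : admissible S e (a, b, c) by rewrite -harr; exact: inv_arrange.
have b0 := le_trans a0 ab.
apply: halts_step; rewrite /etma_step harr.
apply: (halts_At3 _ b0 hi') => [|na|x' z' _ _ nx']; first by rewrite a0 a2.
  apply: halts_At5_ordered => //; apply: (halts_At6 na b0 bc hi') => [|_]; first by rewrite leNgt b2.
  apply: (halts_At7 a0 _ hi') => [|nb|y' z' _ _ ny']; first by rewrite b0 b2.
    apply: halts_step; rewrite /etma_step ltNge ab.
    apply: (halts_At10 na nb ab hi') => [c2'|_]; last by rewrite ltNge bc.
    by move: c2; rewrite ltNge (le_trans c2' (ler_norm c)).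
  by rewrite ht; exact: halts_At9.
by rewrite ht => hi''; apply: (halts_round_At5 K1 K2 nx' b0 hi''); rewrite leNgt b2.
Qed.

End Invariants.

End Algorithm.

(** * Termination *)

Section Termination.
Variables (R : realType) (A B : PSL2 R).
Implicit Types (x y z e : R) (t : triple R).

Let Sall : R -> Prop := fun=> True.

Let Sall_subring : subring_pred Sall. Proof. by []. Qed.

Lemma count_lt_strict (s : seq R) x y : x < y -> x \in s ->
  (count (fun v => v < x)%R s < count (fun v => v < y)%R s)%N.
Proof.
move=> xy; elim: s => // a s IH; rewrite inE => /orP[/eqP<-|/IH {}IH] /=.
  rewrite ltxx xy add0n add1n ltnS; apply: sub_count => v /= vx.
  exact: lt_trans xy.
rewrite -addnS leq_add //; case: (ltP a x) => //= ax.
by rewrite (lt_trans ax xy).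
Qed.

Lemma cos_ring_subring N : subring_pred (@cos_ring R N).
Proof.
by split; [exact: cos_ring1|exact: cos_ringB|exact: cos_ringM].
Qed.

(** The steps use ring operations only, so all later entries stay in [cos_ring N], where
    denominators of angles are bounded. The induction is on the number of possible values of [tau]
    below the current one. *)
Lemma angles_halt_all e : angles_halt A B Sall e.
Proof.
move=> x y z hi [p1 [q1 h1]] [p2 [q2 h2]] [p3 [q3 h3]].
pose N := (q1 * q2 * q3)%N.
have N0 : (0 < N)%N.
  by rewrite !muln_gt0; case: h1 h2 h3 => [/ltnW-> _ _ _] [/ltnW-> _ _ _] [/ltnW-> _ _ _].
have HS := cos_ring_subring N.
have Sabs (u : R) : cos_ring N `|u| -> cos_ring N u.
  by case: (ger0P u) => _ // h; rewrite -[u]opprK; apply: (subring_opp HS).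
have absS (u : R) : cos_ring N u -> cos_ring N `|u|.
  by case: (ger0P u) => _ // h; apply: (subring_opp HS).
have {}hi : admissible A B (cos_ring N) e (x, y, z).
  case: hi => hr _ k1 k2 k3; suff hS : [/\ cos_ring N x, cos_ring N y & cos_ring N z] by split.
  split; apply: Sabs.
  - by apply: cos_ring_rational_angle h1 => //; rewrite /N -mulnA dvdn_mulr.
  - by apply: cos_ring_rational_angle h2 => //; rewrite /N mulnAC dvdn_mull.
  - by apply: cos_ring_rational_angle h3 => //; rewrite /N dvdn_mull.
have [D hD] := cos_ring_denominators R N0.
(* The list only has to contain every absolute value that can occur; signs are added in [svals]. *)
pose vals := [seq 2 * cos (p%:R * pi / q%:R) : R | p <- iota 0 D.+1, q <- iota 0 D.+1].
pose svals := vals ++ map -%R vals.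
pose taus := [seq tau (ab.1, ab.2, c) | ab <- [seq (a, b) | a <- svals, b <- svals], c <- svals].
have mem_svals (u : R) : cos_ring N u -> angle `|u| -> u \in svals.
  move=> /absS su [p [q hu]]; have qD := hD _ _ _ su hu.
  have /andP[_ pq] := rational_angle_bounds hu.
  have : `|u| \in vals.
    case: hu => _ _ _ ->; apply: (allpairs_f (fun p q : nat => 2 * cos (p%:R * pi / q%:R) : R));
      rewrite mem_iota add0n ltnS //.
    by rewrite (leq_trans (ltnW pq)).
  move: (vals) @svals taus => vs svals taus; rewrite /svals mem_cat.
  case: (ger0P u) => _ hv; first by rewrite hv.
  by rewrite -[u in X in _ || X]opprK map_f // orbT.
have main n : forall e x y z, admissible A B (cos_ring N) e (x, y, z) ->
    (count (fun v => v < tau (x, y, z))%R taus < n)%N ->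
    angle `|x| -> angle `|y| -> angle `|z| -> halts A B (At 2 (x, y, z)).
  elim: n => // n IH {hi h1 h2 h3} e' {}x {}y {}z hi hn hx hy hz.
  apply: (halts_angles_step HS hi hx hy hz) => a b c hi' ha hb hc.
  apply: (IH _ _ _ _ hi' _ ha hb hc); move: hn; rewrite ltnS; apply: leq_trans.
  case: (hi') => _ [sa sb sc] _ _ lt; apply: count_lt_strict => //.
  have ma : a \in svals := mem_svals _ sa ha.
  have mb : b \in svals := mem_svals _ sb hb.
  have mc : c \in svals := mem_svals _ sc hc.
  exact: (allpairs_f (fun ab c => tau (ab.1, ab.2, c)) (allpairs_f pair ma mb) mc).
by apply: (main _ _ _ _ _ hi (ltnSn _)); [exists p1, q1|exists p2, q2|exists p3, q3].
Qed.

Lemma flip_halts_all e : flip_halts A B Sall e.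
Proof. by apply: angles_flip => //; exact: angles_halt_all. Qed.

Hypothesis hell : exists W, generated A B W /\ elliptic W.

(** If [x >= 2], all absolute values are at least 2, and the sign of the product forces [z <= -2].
    Then [no_elliptic] contradicts the elliptic element carried over from [A] and [B]. *)
Lemma arranged_lt2 e x y z : 0 <= x -> x <= y -> y <= `|z| -> x * y * z <= 0 ->
  admissible A B Sall e (x, y, z) -> x < 2.
Proof.
move=> x0 xy yz xyz [[M [N [hMN ht]]] _ htau _ _]; rewrite ltNge; apply/negP => x2.
have y2 : 2 <= y by exact: le_trans xy.
have z2 : z <= - 2.
  have := le_trans y2 yz; rewrite ler_normr => /orP[z2|]; last by rewrite lerNr.
  have xy0 : 0 < x * y by apply: mulr_gt0; lra.
  by nra.
have [W [hW]] := hell; have [hA hB] := ext_nielsen_generated hMN.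
have := generated_trans hA hB hW.
by case: ht => ex ey ez; apply: no_elliptic; rewrite -?ex -?ey -?ez.
Qed.

Lemma halts_minimized e x y z : 0 <= x -> 0 <= y -> z < 0 ->
  admissible A B Sall e (x, y, z) -> halts A B (At 2 (x, y, z)).
Proof.
move=> x0 y0 z0 hi; have [a [b [c [harr a0 ab bc _]]]] := arrangeP (x, y, z).
have hi' : admissible A B Sall e (a, b, c) by rewrite -harr; exact: inv_arrange.
apply: (halts_round_At2 Sall_subring (@flip_halts_all e) (@angles_halt_all e) harr _ hi).
  apply: arranged_lt2 hi' => //; rewrite (arrange_prod harr).
  by rewrite mulr_ge0_le0 // ?mulr_ge0 // ltW.
move=> _ x' y' z' hi'' nx' y2 yz.
exact: (halts_large_pair Sall_subring (@flip_halts_all e) (@angles_halt_all e)).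
Qed.

Lemma halts_tma_step e x y z : 0 <= x -> x <= y -> y <= z -> admissible A B Sall e (x, y, z) ->
  (forall x' y' z', 0 <= x * y - z -> 0 <= x' -> x' <= y' -> y' <= z' -> x' <= x ->
    x' + y' + z' = x + y + (x * y - z) -> tau (x', y', z') = tau (x, y, z) ->
    admissible A B Sall e (x', y', z') -> halts A B (Tma (x', y', z'))) ->
  halts A B (Tma (x, y, z)).
Proof.
move=> x0 xy yz hi IH; have y0 := le_trans x0 xy; have z0 := le_trans y0 yz.
apply: halts_step; rewrite /etma_step (le_gtF x0) (le_gtF z0).
set w := x * y - z; have hi' : admissible A B Sall e (x, y, w) := inv_flip Sall_subring hi.
have := @sort3_sorted R <=%R (x, y, w) le_total.
have [w0|w0] := leP 0 w.
  pose P (t : triple R) := [/\ admissible A B Sall e t,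
    [/\ 0 <= t.1.1, 0 <= t.1.2 & 0 <= t.2], t.1.1 + t.1.2 + t.2 = x + y + w,
    tau t = tau (x, y, z) & x \in [:: t.1.1; t.1.2; t.2]].
  have : P (sort3 <=%R (x, y, w)).
    apply: sort3_ind; last first.
      by split; [exact: hi'|split|by []|exact: tau_flip|exact: mem_head].
    split=> a b c [h1 [h2 h3 h4] h5 h6 h7].
      split=> //; first exact: (inv_permutable _ _ _ _).1.
      + by rewrite -h5 /= [b + a]addrC.
      + by rewrite tau_swap12.
      + by move: h7; rewrite !inE /= orbCA.
    split=> //; first exact: (inv_permutable _ _ _ _).2.
    + by rewrite -h5 /= addrAC.
    + by rewrite tau_swap23.
    + by move: h7; rewrite !inE /= [X in _ || X]orbC.
  case: (sort3 _ _) => [[a b] c] [h1 [h2 h3 h4] h5 h6 h7] /andP[ab bc].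
  apply: IH => //; move: h7; rewrite !inE => /or3P[] /eqP /= -> //.
  exact: le_trans ab bc.
have -> : sort3 <=%R (x, y, w) = (w, x, y).
  rewrite /sort3 (_ : sort _ _ = [:: w; x; y]) //.
  apply: (sorted_eq le_trans le_anti); first exact: (sort_sorted (@le_total _ R)).
    by rewrite /= xy (le_trans (ltW w0)).
  by rewrite perm_sort; exact: (permEl (perm_catC [:: x; y] [:: w])).
move=> _; apply: halts_step; rewrite /etma_step w0 switch_signs_id //.
exact: halts_minimized hi'.
Qed.

Lemma bounded_multiple (c d : R) : 0 < d -> exists n : nat, c < n%:R * d.
Proof.
move=> d0; exists (Num.bound `|c / d|).
by rewrite -ltr_pdivrMr // (le_lt_trans (ler_norm _)) // archi_boundP.
Qed.

Lemma halts_tma_lt2 e x y z : x < 2 -> 0 <= x -> x <= y -> y <= z ->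
  admissible A B Sall e (x, y, z) -> halts A B (Tma (x, y, z)).
Proof.
move=> x2; pose d := (2 - x) / 2; have d0 : 0 < d by rewrite /d; lra.
have [n hn] := bounded_multiple (x + y + z) d0.
have : x <= 2 - 2 * d by rewrite /d; lra.
clearbody d; move: d0 => /[swap]; move: hn.
elim: n x y z {x2} => [|n IH] x y z hn xd d0 x0 xy yz hi; first by lra.
apply: (halts_tma_step x0 xy yz hi) => x' y' z' w0 x'0 xy' yz' xx' hs _ hi'.
apply: (IH) => //; last exact: le_trans xd.
have h5 : 2 < tau (x, y, z) by case: hi.
(* The sum drops by [2 z - x y >= 2 d y]. Entries in [0, 1] would give [tau <= 1], so
   [1 < z <= x y < 2 y] and the drop exceeds [d]. *)
have z1 : 1 < z.
  rewrite ltNge; apply/negP => z1; move: h5; rewrite /tau; nra.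
have y1 : 1 < 2 * y by nra.
move: hn; rewrite hs -addn1 natrD mulrDl mul1r; nra.
Qed.

Lemma halts_tma e x y z : 0 <= x -> x <= y -> y <= z ->
  admissible A B Sall e (x, y, z) -> halts A B (Tma (x, y, z)).
Proof.
move=> x0 xy yz hi; pose d := Num.sqrt (tau (x, y, z) - 2).
have d0 : 0 < d by rewrite sqrtr_gt0; case: hi => _ _; lra.
have [n hn] := bounded_multiple (x + y + z) d0.
have : tau (x, y, z) = 2 + d ^+ 2.
  by rewrite sqr_sqrtr; [ring|case: hi => _ _; lra].
clearbody d; move: hn.
elim: n x y z x0 xy yz hi => [|n IH] x y z x0 xy yz hi hn ht; first by lra.
have [x2|x2] := ltP x 2; first exact: (halts_tma_lt2 x2 x0 xy yz hi).
apply: (halts_tma_step x0 xy yz hi) => x' y' z' w0 x'0 xy' yz' xx' hs ht' hi'.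
apply: IH => //; last by rewrite ht'.
(* Otherwise [y <= z <= x y / 2], so [tau] is at most its value at [z = y], and [tau (x, y, y) - 2 =
   (2 - x) (y^2 - x - 2) <= 0]. *)
have h1 : x * y < 2 * z.
  rewrite ltNge; apply/negP => h; move: ht; rewrite /tau => ht.
  have h2 : (z - y) * (z + y - x * y) <= 0 by nra.
  have h3 : (2 - x) * (y ^+ 2 - x - 2) <= 0 by nra.
  by nra.
(* Completing the square in [z] bounds the drop [2 z - x y] of the entry sum from below. *)
have h2 : (2 * z - x * y) ^+ 2 = (x ^+ 2 - 4) * (y ^+ 2 - 4) + 4 * d ^+ 2.
  have -> : d ^+ 2 = tau (x, y, z) - 2 by rewrite ht; ring.
  by rewrite /tau; ring.
have h3 : d <= 2 * z - x * y.
  rewrite leNgt; apply/negP => h3.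
  have h4 : 0 <= (x ^+ 2 - 4) * (y ^+ 2 - 4) by apply: mulr_ge0; nra.
  nra.
by rewrite hs; move: hn; rewrite -addn1 natrD mulrDl mul1r; lra.
Qed.

Lemma halts_start t : reached A B t -> 2 < tau t -> tau t <= comm_tr A B ->
  halts A B (start t).
Proof.
move=> hr h1 h2; rewrite /start h1.
(* Adding 1 makes the initial bound on [tau] strict. *)
have hi : admissible A B Sall (comm_tr A B + 1) t by split=> //; lra.
have [x [y [z [harr x0 xy yz _]]]] := arrangeP t.
have := inv_arrange _ hi; rewrite harr => /(_ Sall_subring) hi'.
have [z0|z0] := leP 0 z.
  by rewrite ger0_norm // in yz; exact: halts_tma hi'.
have y0 := le_trans x0 xy.
apply: halts_step; rewrite /etma_step (le_gtF x0) z0 switch_signs_id //.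
exact: halts_minimized hi'.
Qed.

End Termination.

Theorem theorem3p12 (R : realType) (A B : PSL2 R)
    (hell : exists W : PSL2 R, generated A B W /\ elliptic W)
    (htau : 2 < comm_tr A B)
    (t : triple R) (ht : trace_triple A B t) :
  etma_returns t NotDiscrete \/
  exists (out : triple R) (x y z : R) (U V : PSL2 R),
    etma_returns t (Triple out) /\ (x, y, z) = in_order out /\
    trace_triple U V (x, y, z) /\
    (* (a) *) ext_nielsen A B U V /\
    (* (b) *) (0 <= x /\ x <= y) /\
    (* (c) *) (2 <= y -> z <= -2) /\
    (exists p : nat,
      (* (d) *) ((2 <= p)%N /\ x = 2 * cos (pi / p%:R)) /\
      (* (e) *) (y < 2 ->
                 exists q : nat, (p <= q)%N /\ y = 2 * cos (pi / q%:R))) /\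
    (* (f) *) (y < 2 ->
       z <= -2 \/
       (y <= `|z| /\
        exists r s : nat,
          [/\ (2 <= s)%N, (1 <= r <= s - 1)%N, coprime r s &
              `|z| = 2 * cos (r%:R * pi / s%:R)])) /\
    (* (g) *) (2 < comm_tr U V /\ comm_tr U V <= comm_tr A B).
Proof.
have hc : comm_tr A B = tau t.
  by case: ht => M [N [<- <- ->]]; rewrite fricke.
have hr := reached_start ht; rewrite hc in htau.
have [|n [u [hn hu]]] := halts_start hell hr htau; first by rewrite hc.
case: hu => [hu|[out [hu [x [y [z [U [V h]]]]]]]].
  by left; exists n; rewrite hn hu.
by right; exists out, x, y, z, U, V; split=> //; exists n; rewrite hn hu.
Qed.
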